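(* For every countable ordinal $\alpha$ there is a position in infinite draughts (played with both the forced-jump rule and the forced-iterated-jump rule) whose game value, with Red as the open player, is exactly $\alpha$.
   Context: Infinite draughts is played by two players, Black and Red, on the infinite checkerboard $\mathbb{Z}\times\mathbb{Z}$, using only the dark squares (say those $(x,y)$ with $x+y$ even). A position consists of an arbitrary (possibly infinite) placement of pieces on dark squares, each piece being a black or red pawn or king, together with a specification of which player is to move. Black pawns move only on upward diagonals, red pawns only on downward diagonals; kings may move along all four diagonal directions. A simple move moves a piece one diagonal step, in a permitted direction, to an empty square. A jump moves a piece over a diagonally adjacent enemy piece (in a permitted direction) to the empty square immediately beyond; the jumped enemy piece is captured and removed. A single piece may perform several jumps in succession (an iterated jump), which together count as one turn; different branches of possible jump sequences may be freely chosen. If a piece performs an infinite iterated jump, then all enemy pieces jumped are removed and the jumping piece itself is also removed from the board (infinite-jump rule). There is no promotion of pawns. Forced-jump rule: if a player has any jumping move available, the player must make a jumping move (choosing freely among available jumps). Forced-iterated-jump rule: after a jump, if the same piece can jump again it must do so, continuing until no further jump with that piece is possible (the sequence may be infinite). A player loses when it is their turn and they have no legal move (e.g. no pieces left, or all pieces blocked); the other player then wins. Infinitely long play is a draw. Thus wins occur at finite stages, making the game open for each player. Game values (with respect to a designated ''open'' player, here Red; the opponent is the ''closed'' player) are defined by transfinite recursion: (1) a position in which the game is already won for the open player has value $0$; (2) if the game is not yet won and it is the open player's turn, and the open player can move to a position having a value, then the value is $\alpha+1$ where $\alpha$ is the least value of a position reachable in one legal move; (3) if it is the closed player's turn and every position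 reachable by a legal move has a value, then the value is the supremum of those values; otherwise the value is undefined. A position with no value assigned is unvalued. *)

(* Defs.v *)
From Stdlib Require Import Bool ZArith Relations.
Open Scope Z_scope.

Inductive color : Type := Black | Red.
Definition opp (c : color) : color := match c with Black => Red | Red => Black end.

Inductive kind : Type := Pawn | King.

Record piece : Type := mkPiece { pcolor : color; pkind : kind }.

Definition board : Type := Z -> Z -> option piece.

Record position : Type := mkPos { pboard : board; pturn : color }.

(* pieces only on dark squares (x + y even) *)
Definition wf_position (p : position) : Prop :=
  forall x y, Z.even (x + y) = false -> pboard p x y = None.

Definition upd (b : board) (x y : Z) (v : option piece) : board :=
  fun u w => if andb (u =? x) (w =? y) then v else b u w.

Definition board_eq (b1 b2 : board) : Prop := forall u w, b1 u w = b2 u w.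

Definition permitted (pc : piece) (dx dy : Z) : Prop :=
  (dx = 1 \/ dx = -1) /\ (dy = 1 \/ dy = -1) /\
  match pkind pc with
  | King => True
  | Pawn => match pcolor pc with Black => dy = 1 | Red => dy = -1 end
  end.

Definition simple_step (b : board) (x y : Z) (b' : board) : Prop :=
  exists pc dx dy,
    b x y = Some pc /\ permitted pc dx dy /\ b (x + dx) (y + dy) = None /\
    board_eq b' (upd (upd b x y None) (x + dx) (y + dy) (Some pc)).

(* a configuration during an iterated jump: current board and location of the jumper *)
Record conf : Type := mkConf { cboard : board; cx : Z; cy : Z }.

Definition jstep (k k' : conf) : Prop :=
  exists pc dx dy e,
    cboard k (cx k) (cy k) = Some pc /\ permitted pc dx dy /\
    cboard k (cx k + dx) (cy k + dy) = Some e /\ pcolor e <> pcolor pc /\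
    cboard k (cx k + 2 * dx) (cy k + 2 * dy) = None /\
    cx k' = cx k + 2 * dx /\ cy k' = cy k + 2 * dy /\
    board_eq (cboard k')
      (upd (upd (upd (cboard k) (cx k) (cy k) None)
                (cx k + dx) (cy k + dy) None)
           (cx k') (cy k') (Some pc)).

Definition jump_avail (k : conf) : Prop := exists k', jstep k k'.

Definition has_jump (c : color) (b : board) : Prop :=
  exists x y pc, b x y = Some pc /\ pcolor pc = c /\ jump_avail (mkConf b x y).

Definition finite_jump (c : color) (b b' : board) : Prop :=
  exists x y pc k,
    b x y = Some pc /\ pcolor pc = c /\
    clos_trans conf jstep (mkConf b x y) k /\
    ~ jump_avail k /\ board_eq b' (cboard k).

(* an infinite iterated jump by a piece of color c: all jumped enemy pieces and
   the jumping piece itself are removed (infinite-jump rule) *)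
Definition infinite_jump (c : color) (b b' : board) : Prop :=
  exists x y pc (f : nat -> conf),
    b x y = Some pc /\ pcolor pc = c /\
    f O = mkConf b x y /\ (forall n, jstep (f n) (f (S n))) /\
    let removed u w :=
      (u = x /\ w = y) \/
      (exists n, 2 * u = cx (f n) + cx (f (S n)) /\ 2 * w = cy (f n) + cy (f (S n))) in
    forall u w, (removed u w -> b' u w = None) /\ (~ removed u w -> b' u w = b u w).

Definition move (p q : position) : Prop :=
  pturn q = opp (pturn p) /\
  (has_jump (pturn p) (pboard p) ->
     finite_jump (pturn p) (pboard p) (pboard q) \/
     infinite_jump (pturn p) (pboard p) (pboard q)) /\
  (~ has_jump (pturn p) (pboard p) ->
     exists x y pc, pboard p x y = Some pc /\ pcolor pc = pturn p /\
                    simple_step (pboard p) x y (pboard q)).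

Definition wonRed (p : position) : Prop :=
  pturn p = Black /\ ~ (exists q, move p q).

Inductive Ord : Type := OSup : forall (Ix : Type), (Ix -> Ord) -> Ord.

(* OSup Ix f denotes sup_i (f i + 1); the usual extensional order *)
Fixpoint ole (a b : Ord) {struct a} : Prop :=
  match a with
  | OSup Ix f => forall i, match b with OSup J g => exists j, ole (f i) (g j) end
  end.

Definition olt (a b : Ord) : Prop :=
  match b with OSup J g => exists j, ole a (g j) end.

Inductive countable_ord : Ord -> Prop :=
| countable_OSup (Ix : Type) (f : Ix -> Ord) :
    (exists g : Ix -> nat, forall i j, g i = g j -> i = j) ->
    (forall i, countable_ord (f i)) -> countable_ord (OSup Ix f).

(* ---------- Game values (Red open) ----------
   LEval p a  <->  p has a value and that value is <= a. *)
Inductive LEval : position -> Ord -> Prop :=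
| LE_won p a : wonRed p -> LEval p a
| LE_red p q a b :
    pturn p = Red -> move p q -> LEval q b -> olt b a -> LEval p a
| LE_black p a :
    pturn p = Black -> ~ wonRed p ->
    (forall q, move p q -> LEval q a) -> LEval p a.

Definition has_value (p : position) (a : Ord) : Prop :=
  LEval p a /\ forall b, LEval p b -> ole a b.

(* Main.v *)
(** Almost the whole board is filled with red pawns.  A jumping black king eats its way along
    one-square-wide tracks, which form an infinite binary tree embedded in the plane without
    crossings: at each fork the king either proceeds to the next sibling or turns towards the
    current child, where the track ends.  Turning to a child removes a red pawn that blocked a
    capture, so Red has exactly one jump; it takes the king that just arrived and also a black
    pawn that had immobilised a second black king, which can then continue on the tracks of the
    child.  Thus Black walks down a tree of ordinals and Red spends one move per descent.  At a
    leaf the second king is replaced by a red pawn and Black has no move left.  A king that never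
    turns off performs an infinite jump and disappears; then any harmless red move wins, which
    does not change the value, since a node that is not a leaf has value at least 1. *)

Require Import Defs.
From Stdlib Require Import ZArith Relations.
From Stdlib Require Import Lia List ClassicalEpsilon.
Import ListNotations.

(** * Layout of the tree of tracks *)

(** The full board controls both players. A capture that leaves the tracks has no empty landing
    square, so a king can only follow them. Red pawns beside a track do have quiet moves, but the
    forced-jump rule forbids these as soon as a capture exists. The binary tree encodes infinite
    branching: a node runs through its children one sibling at a time, so a fork has just two exits,
    left and up. Since a king moves only left and up, it never meets the squares that it has
    emptied, and the next king starts in a part of the board still untouched. The proof therefore
    compares every position with one static board and records only which squares may differ. Rows
    and columns are 32 apart, far more than the gadgets need, so every local question concerns a
    node, its parent and its two successors, and is left to linear arithmetic. A round consists of
    Black's choice of a member and one move of Red; this yields sup (f i + 1), exactly the recursion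
    of [OSup]. *)

(* Diagonal coordinates are used throughout: (u, v) is the square (u - v, u + v) of the board, so
   that black pawns move by (1, 0) and (0, 1), red pawns by (-1, 0) and (0, -1).

   The nodes of the binary tree are the positive numbers: [xI q] is the next sibling of [q] and
   [xO q] is the child of [q].  The tracks of [p] climb the column [vcol p] from [vstart p] to
   [hrow p] and then run left along that row to [hend p].  Each row belongs to one node, and
   [Zpos p + col p] is a power of 2, which is what keeps the tracks apart.  [parity] is needed
   because the king of a child moves on squares of the other parity class. *)
Fixpoint col (p : positive) : Z :=
  match p with xH => 1 | xI q => 2 * col q - 1 | xO q => 2 * col q end.
Fixpoint parity (p : positive) : Z :=
  match p with xH => 0 | xI q => parity q | xO q => 1 - parity q end.

Definition vcol (p : positive) : Z := parity p - 32 * col p.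
Definition hrow (p : positive) : Z := 32 * Zpos p + parity p.
Definition hend (p : positive) : Z := 4 - parity p - 64 * col p.
Definition vstart (p : positive) : Z :=
  match p with xH => hrow xH | xI q => hrow q | xO q => hrow q + 3 end.

Lemma colI q : col (xI q) = 2 * col q - 1. Proof. reflexivity. Qed.
Lemma colO q : col (xO q) = 2 * col q. Proof. reflexivity. Qed.
Lemma parityI q : parity (xI q) = parity q. Proof. reflexivity. Qed.
Lemma parityO q : parity (xO q) = 1 - parity q. Proof. reflexivity. Qed.
Lemma vstartI q : vstart (xI q) = hrow q. Proof. reflexivity. Qed.
Lemma vstartO q : vstart (xO q) = hrow q + 3. Proof. reflexivity. Qed.
Lemma vstartH : vstart xH = 32. Proof. reflexivity. Qed.
Lemma colH : col xH = 1. Proof. reflexivity. Qed.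
Lemma parityH : parity xH = 0. Proof. reflexivity. Qed.
#[global] Opaque col parity vstart.

Lemma node_bounds p : 1 <= col p <= Zpos p /\ 0 <= parity p <= 1.
Proof.
  induction p as [q IH|q IH|]; rewrite ?colI, ?colO, ?parityI, ?parityO, ?colH, ?parityH; lia.
Qed.

(** Only child nodes begin with a waiting king and a gadget; a next sibling continues a track that
    is already being walked. *)
Definition far (p : positive) : Prop := match p with xO _ => True | _ => False end.

Lemma vstart_bounds p : vstart p <= 32 * Zpos p + parity p /\ (far p -> vstart p + 24 <= 32 * Zpos p + parity p).
Proof.
  destruct p as [q|q|]; rewrite ?vstartI, ?vstartO, ?vstartH; unfold hrow;
    try pose proof (node_bounds q);
    rewrite ?parityI, ?parityO, ?parityH; simpl far; lia.
Qed.

(** Both successors double [Zpos p + col p], so the exponent is the depth plus 1. Within one depth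
    the columns are thus ordered opposite to the rows. *)
Lemma row_col_pow2 p : exists n : nat, Zpos p + col p = 2 ^ Z.of_nat n.
Proof.
  induction p as [q [n IH]|q [n IH]|].
  - exists (S n). rewrite colI, Nat2Z.inj_succ, Z.pow_succ_r; lia.
  - exists (S n). rewrite colO, Nat2Z.inj_succ, Z.pow_succ_r; lia.
  - exists 1%nat. reflexivity.
Qed.

(** The comparison of depths in a form that [lia] can use. *)
Lemma row_col_trichotomy p q :
  Zpos p + col p = Zpos q + col q \/
  2 * (Zpos p + col p) <= Zpos q + col q \/ 2 * (Zpos q + col q) <= Zpos p + col p.
Proof.
  assert (H : forall i j : nat, (i < j)%nat -> 2 * 2 ^ Z.of_nat i <= 2 ^ Z.of_nat j).
  { intros i j ij. rewrite <- Z.pow_succ_r by lia. apply Z.pow_le_mono_r; lia. }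
  destruct (row_col_pow2 p) as [i ->], (row_col_pow2 q) as [j ->].
  destruct (Nat.lt_trichotomy i j) as [ij|[->|ij]]; auto.
Qed.

(** The margin 8 covers the gadget and the squares around it, and is small against the spacing
    32. *)
Definition zone (p : positive) (x y : Z) : Prop :=
  (hrow p - 8 <= y <= hrow p + 8 /\ hend p - 8 <= x <= vcol p + 8) \/
  (vcol p - 8 <= x <= vcol p + 8 /\ vstart p - 8 <= y <= hrow p + 8).

Ltac bounds :=
  repeat match goal with
  | H : context [col ?p] |- _ =>
      is_var p; lazymatch goal with _ : 1 <= col p <= _ /\ _ |- _ => fail | _ => pose proof (node_bounds p); pose proof (vstart_bounds p) end
  | |- context [col ?p] =>
      is_var p; lazymatch goal with _ : 1 <= col p <= _ /\ _ |- _ => fail | _ => pose proof (node_bounds p); pose proof (vstart_bounds p) end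
  | H : context [parity ?p] |- _ =>
      is_var p; lazymatch goal with _ : 1 <= col p <= _ /\ _ |- _ => fail | _ => pose proof (node_bounds p); pose proof (vstart_bounds p) end
  | |- context [parity ?p] =>
      is_var p; lazymatch goal with _ : 1 <= col p <= _ /\ _ |- _ => fail | _ => pose proof (node_bounds p); pose proof (vstart_bounds p) end
  end.
Ltac coords :=
  unfold vcol, hrow, hend in *;
  rewrite ?vstartI, ?vstartO, ?vstartH in *; unfold vcol, hrow, hend in *;
  do 2 rewrite ?colI, ?colO, ?parityI, ?parityO, ?colH, ?parityH in *;
  bounds.

Definition adjacent (p q : positive) : Prop := p = xO q \/ p = xI q \/ q = xO p \/ q = xI p.

(** The row of [p] meets the column that climbs from [s] to [q]. At the depth of [q], the opposite
    orders of rows and columns force [p = q]. At the depth of [s] they give [col p <= col s], while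
    [2 * col p >= col q >= 2 * col s - 1], so [p = s]. *)
Lemma sep_col p s q :
  (q = xO s \/ q = xI s) -> Zpos s <= Zpos p <= Zpos q -> col p <= col q <= 2 * col p ->
  p = q \/ p = s.
Proof.
  intros Hq Hr Hc.
  assert (Zpos p = Zpos q \/ Zpos p = Zpos s); [|destruct H as [[=]|[=]]; auto].
  pose proof (row_col_trichotomy p s). pose proof (row_col_trichotomy p q).
  destruct Hq as [-> | ->]; coords; lia.
Qed.

(** Columns of different depths overlap only in column 1: the overlap puts [p] at the depth of [s],
    in a row not below it, so [col p <= col s], whereas [col p = col q >= 2 * col s - 1]. *)
Lemma sep_ver p q s x y : (q = xO s \/ q = xI s) ->
  vcol p - 8 <= x <= vcol p + 8 -> vstart p - 8 <= y <= hrow p + 8 ->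
  vcol q - 8 <= x <= vcol q + 8 -> vstart q - 8 <= y <= hrow q + 8 ->
  Zpos p + col p < Zpos q + col q -> p = s.
Proof.
  intros Hq H1 H2 H3 H4 H5.
  enough (Zpos p = Zpos s) as [=] by auto.
  pose proof (row_col_trichotomy p s). pose proof (row_col_trichotomy p q).
  destruct Hq as [-> | ->]; coords; lia.
Qed.

(** This is the sense in which the tree is drawn without crossings. The mixed case, a row against a
    column, is [HV]. *)
Lemma zone_sep p q x y : zone p x y -> zone q x y -> p = q \/ adjacent p q.
Proof.
  assert (HV : forall p q, hrow p - 8 <= y <= hrow p + 8 /\ hend p - 8 <= x <= vcol p + 8 ->
     vcol q - 8 <= x <= vcol q + 8 /\ vstart q - 8 <= y <= hrow q + 8 -> p = q \/ adjacent p q).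
  { clear p q. intros p q Hp Hq. destruct q as [s|s|].
    - destruct (sep_col p s (xI s)) as [->| ->]; unfold adjacent; auto; coords; lia.
    - destruct (sep_col p s (xO s)) as [->| ->]; unfold adjacent; auto; coords; lia.
    - left. enough (Zpos p = 1) as [=] by auto. coords; lia. }
  intros [Hp|Hp] [Hq|Hq].
  - left. enough (Zpos p = Zpos q) as [=] by auto. coords; lia.
  - auto.
  - destruct (HV q p) as [->|H]; auto. unfold adjacent in *; tauto.
  - assert (col p = col q) as E by (coords; lia).
    destruct (Z.lt_trichotomy (Zpos p + col p) (Zpos q + col q)) as [L|[L|L]].
    + right. destruct q as [s|s|].
      * rewrite (sep_ver p (xI s) s x y); unfold adjacent; auto; tauto.
      * rewrite (sep_ver p (xO s) s x y); unfold adjacent; auto; tauto.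
      * coords; lia.
    + left. enough (Zpos p = Zpos q) as [=] by auto. lia.
    + right. destruct p as [s|s|].
      * rewrite (sep_ver q (xI s) s x y); unfold adjacent; auto; tauto.
      * rewrite (sep_ver q (xO s) s x y); unfold adjacent; auto; tauto.
      * coords; lia.
Qed.

(** * Tracks, gadgets and the empty squares *)

Definition on_row (p : positive) (x y : Z) : Prop := y = hrow p /\ hend p <= x <= vcol p.
Definition on_column (p : positive) (x y : Z) : Prop := x = vcol p /\ vstart p <= y <= hrow p.
(* The third part is the initial piece of a child's track, from its king to its column. *)
Definition track (p : positive) (x y : Z) : Prop :=
  on_row p x y \/ on_column p x y \/ (far p /\ y = vstart p /\ vcol p <= x <= vcol p + 3).
(* With (a, b) = (vcol p, vstart p), a king on the parent's track comes up from (a+3, b-3) to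
   (a+3, b-1), captures the pawn at (a+2, b-1) and stops at (a+1, b-1).  Now the red pawn at
   (a+2, b+1) jumps over the black pawn at (a+2, b) and then over the king, ending at (a, b-1).
   The black king waiting at (a+4, b) can then jump to (a+2, b) and (a, b): the black pawn it
   replaces could not have made the second jump, which is to the left. *)
Definition gadget (p : positive) (x y : Z) : Prop :=
  far p /\
  (y = vstart p - 2 /\ x = vcol p + 3 \/ y = vstart p - 1 /\ vcol p <= x <= vcol p + 3 \/
   y = vstart p /\ (x = vcol p + 2 \/ x = vcol p + 4) \/ y = vstart p + 1 /\ x = vcol p + 2).
Definition touches (p : positive) (x y : Z) : Prop := track p x y \/ gadget p x y.

Definition vacant (p : positive) (x y : Z) : Prop :=
  ((on_row p x y \/ on_column p x y) /\ (x + y) mod 2 = 0) \/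
  (far p /\ y = vstart p - 1 /\ (x = vcol p + 3 \/ x = vcol p + 1 \/ x = vcol p)).
(* The isolated square (20, 0) lets Red make a harmless move after an infinite jump. *)
Definition empty_sq (x y : Z) : Prop := (x = 20 /\ y = 0) \/ exists p, vacant p x y.

Ltac unfold_squares := unfold touches, vacant, track, on_row, on_column, gadget, zone in *.

Lemma touches_zone p x y : touches p x y -> zone p x y.
Proof. destruct p; unfold_squares; coords; simpl far; lia. Qed.

Lemma vacant_touches p x y : vacant p x y -> touches p x y.
Proof. unfold_squares; intros [[[H|H] _]|[F H]]; auto. right; split; auto; lia. Qed.

Lemma touches_left p x y : touches p x y -> x < 0 /\ 0 < y.
Proof. destruct p; unfold_squares; coords; simpl far; lia. Qed.

(** Once arithmetic places the square of [H : touches q x y] in the zone of [p], only [p], its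
    parent and its two successors remain for [q]. *)
Ltac near p H :=
  lazymatch type of H with
  | touches ?q ?x ?y =>
    let Z := fresh in
    assert (Z : zone p x y) by (clear H; unfold_squares; coords; simpl far in *; lia);
    destruct (zone_sep p q x y Z (touches_zone q x y H)) as [?|[?|[?|[?|?]]]]; clear Z; try discriminate;
    repeat match goal with
    | E : xO _ = xO _ |- _ => injection E as E
    | E : xI _ = xI _ |- _ => injection E as E
    end; subst
  end.
Ltac finish := unfold_squares; coords; simpl far in *; try (exfalso; lia); try lia.

(* As long as these squares stay occupied, the black pieces waiting at [p] can neither move nor
   be captured. *)
Definition guard (p : positive) (x y : Z) : Prop :=
  y = vstart p /\ vcol p + 1 <= x <= vcol p + 6 \/
  x = vcol p + 4 /\ vstart p - 2 <= y <= vstart p + 2 \/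
  x = vcol p + 2 /\ vstart p - 1 <= y <= vstart p + 2.

Lemma guard_touches p q x y : far p -> guard p x y -> touches q x y -> q = p.
Proof.
  intros F G T. unfold guard in G. destruct p as [p|p|]; try easy.
  near (xO p) T; auto; finish.
Qed.

Lemma guard_not_empty p x y : far p -> guard p x y -> ~ empty_sq x y.
Proof.
  intros F G [[-> ->]|[q V]].
  - unfold guard in G. destruct p as [p|p|]; try easy. finish.
  - pose proof (guard_touches _ _ _ _ F G (vacant_touches _ _ _ V)). subst q.
    unfold guard in G. destruct p as [p|p|]; try easy. finish.
Qed.

(** Squares that no walk ever changes, hence always red pawns. The lemmas below find them where
    captures off the track would have to land; [x < 0] keeps away from the empty square
    [(20, 0)]. *)
Definition clear_area (x y : Z) : Prop := x < 0 /\ forall q, ~ touches q x y.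

Ltac clear_by p := split; [finish | let T := fresh in intros ? T; near p T; finish].
Ltac clear_node p := destruct p as [p|p|]; [clear_by (xI p)|clear_by (xO p)|clear_by xH].

Lemma clear_ver_left p y : vstart p < y < hrow p \/ far p /\ y = vstart p -> clear_area (vcol p - 2) y.
Proof. intros H. clear_node p. Qed.
Lemma clear_ver_right p y : vstart p + 2 <= y < hrow p -> clear_area (vcol p + 2) y.
Proof. intros H. clear_node p. Qed.
Lemma clear_ver_down p : far p -> clear_area (vcol p) (vstart p - 2).
Proof. intros H. clear_node p. Qed.
Lemma clear_hor_left p : clear_area (hend p - 2) (hrow p).
Proof. clear_node p. Qed.
Lemma clear_hor_right p : clear_area (vcol p + 2) (hrow p).
Proof. clear_node p. Qed.
Lemma clear_hor_up p x : hend p < x <= vcol p -> x <> vcol (xI p) -> clear_area x (hrow p + 2).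
Proof. intros H H'. clear_node p. Qed.
Lemma clear_hor_down p x : hend p <= x < vcol p -> clear_area x (hrow p - 2).
Proof. intros H. clear_node p. Qed.

Lemma clear_gadget p x y : far p ->
  y = vstart p + 2 /\ (vcol p + 1 <= x <= vcol p + 4) \/
  y = vstart p + 1 /\ (x = vcol p + 1 \/ vcol p + 3 <= x <= vcol p + 4) \/
  y = vstart p /\ vcol p + 5 <= x <= vcol p + 6 \/
  y = vstart p - 1 /\ (x = vcol p - 1 \/ vcol p + 4 <= x <= vcol p + 5) \/
  y = vstart p - 2 /\ (vcol p <= x <= vcol p + 2 \/ x = vcol p + 4) \/
  y = vstart p - 3 /\ x = vcol p + 1 -> clear_area x y.
Proof. intros H H'. clear_node p. Qed.

(** * The rules in diagonal coordinates *)

Definition square (bd : board) (x y : Z) : option piece := bd (x - y) (x + y).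
Definition dark (bd : board) : Prop := forall x y, Z.even (x + y) = false -> bd x y = None.

Definition BK : piece := mkPiece Black King.
Definition BP : piece := mkPiece Black Pawn.
Definition RP : piece := mkPiece Red Pawn.

Definition dir (pc : piece) (du dv : Z) : Prop :=
  match pkind pc, pcolor pc with
  | King, _ => (du = 1 \/ du = -1) /\ dv = 0 \/ du = 0 /\ (dv = 1 \/ dv = -1)
  | Pawn, Black => du = 1 /\ dv = 0 \/ du = 0 /\ dv = 1
  | Pawn, Red => du = -1 /\ dv = 0 \/ du = 0 /\ dv = -1
  end.

Lemma permitted_dir pc du dv : permitted pc (du - dv) (du + dv) <-> dir pc du dv.
Proof. unfold permitted, dir. destruct pc as [[|] [|]]; cbn; lia. Qed.

Lemma permitted_uv pc dx dy : permitted pc dx dy ->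
  exists du dv, dx = du - dv /\ dy = du + dv /\ dir pc du dv.
Proof.
  intros H. assert (E : exists du dv, dx = du - dv /\ dy = du + dv).
  { destruct H as ([-> | ->] & [-> | ->] & _);
      [exists 1, 0 | exists 0, (-1) | exists 0, 1 | exists (-1), 0]; lia. }
  destruct E as (du & dv & -> & ->). exists du, dv. rewrite permitted_dir in H. auto.
Qed.

Lemma dark_uv bd x y pc : dark bd -> bd x y = Some pc -> exists u v, x = u - v /\ y = u + v.
Proof.
  intros D E. destruct (Z.even (x + y)) eqn:Ev.
  - apply Z.even_spec in Ev as [k Hk]. exists k, (y - k). lia.
  - rewrite D in E by assumption. discriminate.
Qed.

Lemma square_upd bd x y v s t :
  square (upd bd (x - y) (x + y) v) s t = if andb (s =? x) (t =? y) then v else square bd s t.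
Proof.
  unfold square, upd.
  destruct (Z.eqb_spec (s - t) (x - y)), (Z.eqb_spec (s + t) (x + y)),
    (Z.eqb_spec s x), (Z.eqb_spec t y); cbn; auto; lia.
Qed.

Lemma dark_upd bd x y v : dark bd -> dark (upd bd (x - y) (x + y) v).
Proof.
  intros D u w H. unfold upd.
  destruct (Z.eqb_spec u (x - y)), (Z.eqb_spec w (x + y)); cbn; auto.
  subst. replace (x - y + (x + y)) with (2 * x) in H by lia.
  rewrite Z.even_mul in H. discriminate.
Qed.

Lemma dark_ext b b' : board_eq b' b -> dark b -> dark b'.
Proof. intros E D x y H. rewrite E. auto. Qed.

Definition jumped (bd bd' : board) (x y du dv : Z) (pc : piece) : Prop :=
  dark bd' /\ square bd' (x + 2 * du) (y + 2 * dv) = Some pc /\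
  square bd' x y = None /\ square bd' (x + du) (y + dv) = None /\
  forall s t, ~ (s = x /\ t = y) -> ~ (s = x + du /\ t = y + dv) ->
    ~ (s = x + 2 * du /\ t = y + 2 * dv) -> square bd' s t = square bd s t.

Definition can_jump (bd : board) (x y du dv : Z) (pc : piece) : Prop :=
  square bd x y = Some pc /\ dir pc du dv /\
  (exists e, square bd (x + du) (y + dv) = Some e /\ pcolor e <> pcolor pc) /\
  square bd (x + 2 * du) (y + 2 * dv) = None.

Lemma dir_nz pc du dv : dir pc du dv ->
  (du = 1 \/ du = -1) /\ dv = 0 \/ du = 0 /\ (dv = 1 \/ dv = -1).
Proof. unfold dir. destruct pc as [[|] [|]]; cbn; lia. Qed.

Lemma eqb_false2 a b c d : ~ (a = b /\ c = d) -> andb (a =? b) (c =? d) = false.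
Proof. destruct (Z.eqb_spec a b), (Z.eqb_spec c d); tauto. Qed.

Lemma jumped_upd bd b' x y du dv pc : dark bd -> dir pc du dv ->
  board_eq b' (upd (upd (upd bd (x - y) (x + y) None) (x + du - (y + dv)) (x + du + (y + dv)) None)
    (x + 2 * du - (y + 2 * dv)) (x + 2 * du + (y + 2 * dv)) (Some pc)) ->
  jumped bd b' x y du dv pc.
Proof.
  intros D P E. apply dir_nz in P.
  assert (Q : forall s t, square b' s t = square (upd (upd (upd bd (x - y) (x + y) None) (x + du - (y + dv)) (x + du + (y + dv)) None)
    (x + 2 * du - (y + 2 * dv)) (x + 2 * du + (y + 2 * dv)) (Some pc)) s t).
  { intros. apply E. }
  split; [|split; [|split; [|split]]].
  - eapply dark_ext; [exact E|]. repeat apply dark_upd. exact D.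
  - rewrite Q, square_upd, !Z.eqb_refl. reflexivity.
  - rewrite Q, !square_upd, eqb_false2, eqb_false2, !Z.eqb_refl by lia. reflexivity.
  - rewrite Q, !square_upd, eqb_false2, !Z.eqb_refl by lia. reflexivity.
  - intros s t H1 H2 H3. rewrite Q, !square_upd, !eqb_false2 by tauto. reflexivity.
Qed.

Lemma jstep_inv k k' x y : dark (cboard k) -> cx k = x - y -> cy k = x + y -> jstep k k' ->
  exists pc du dv, can_jump (cboard k) x y du dv pc /\ jumped (cboard k) (cboard k') x y du dv pc /\
    cx k' = x + 2 * du - (y + 2 * dv) /\ cy k' = x + 2 * du + (y + 2 * dv).
Proof.
  intros D Ex Ey (pc & dx & dy & e & H1 & H2 & H3 & H4 & H5 & H6 & H7 & H8).
  destruct (permitted_uv _ _ _ H2) as (du & dv & -> & -> & P).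
  rewrite Ex, Ey in *. exists pc, du, dv.
  assert (S1 : cx k' = x + 2 * du - (y + 2 * dv)) by lia.
  assert (S2 : cy k' = x + 2 * du + (y + 2 * dv)) by lia.
  split; [|split; [|auto]].
  - unfold can_jump, square. repeat split; auto.
    + exists e. split; auto. rewrite <- H3. f_equal; lia.
    + rewrite <- H5. f_equal; lia.
  - apply jumped_upd; auto. rewrite S1, S2 in H8.
    replace (x - y + (du - dv)) with (x + du - (y + dv)) in H8 by lia.
    replace (x + y + (du + dv)) with (x + du + (y + dv)) in H8 by lia. exact H8.
Qed.

Lemma jstep_intro k x y du dv pc : dark (cboard k) -> cx k = x - y -> cy k = x + y ->
  can_jump (cboard k) x y du dv pc -> exists k', jstep k k' /\
    jumped (cboard k) (cboard k') x y du dv pc /\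
    cx k' = x + 2 * du - (y + 2 * dv) /\ cy k' = x + 2 * du + (y + 2 * dv).
Proof.
  intros D Ex Ey (H1 & H2 & (e & H3 & H4) & H5).
  exists (mkConf (upd (upd (upd (cboard k) (x - y) (x + y) None)
      (x + du - (y + dv)) (x + du + (y + dv)) None)
      (x + 2 * du - (y + 2 * dv)) (x + 2 * du + (y + 2 * dv)) (Some pc))
      (x + 2 * du - (y + 2 * dv)) (x + 2 * du + (y + 2 * dv))).
  split; [|cbn; split; [apply jumped_upd; auto; intros ? ?; reflexivity|auto]].
  exists pc, (du - dv), (du + dv), e. rewrite permitted_dir, Ex, Ey. cbn [cx cy cboard].
  replace (x - y + (du - dv)) with (x + du - (y + dv)) by lia.
  replace (x + y + (du + dv)) with (x + du + (y + dv)) by lia.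
  replace (x - y + 2 * (du - dv)) with (x + 2 * du - (y + 2 * dv)) by lia.
  replace (x + y + 2 * (du + dv)) with (x + 2 * du + (y + 2 * dv)) by lia.
  unfold square in *. repeat split; auto.
Qed.

Lemma has_jump_inv c bd : dark bd -> has_jump c bd ->
  exists x y du dv pc, pcolor pc = c /\ can_jump bd x y du dv pc.
Proof.
  intros D (X1 & Y1 & pc & H1 & H2 & k' & J).
  destruct (dark_uv _ _ _ _ D H1) as (x & y & -> & ->).
  destruct (jstep_inv (mkConf bd (x - y) (x + y)) k' x y) as (pc' & du & dv & C & _); auto.
  exists x, y, du, dv, pc'. split; auto. destruct C as (C & _).
  cbn in C. unfold square in C. congruence.
Qed.

Lemma has_jump_intro bd x y du dv pc : dark bd -> can_jump bd x y du dv pc ->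
  has_jump (pcolor pc) bd.
Proof.
  intros D C. exists (x - y), (x + y), pc. split; [apply C|split; [reflexivity|]].
  destruct (jstep_intro (mkConf bd (x - y) (x + y)) x y du dv pc) as (k' & J & _); auto.
  exists k'. exact J.
Qed.

Lemma simple_step_inv bd x y b' : dark bd -> simple_step bd x y b' ->
  exists u v pc du dv, x = u - v /\ y = u + v /\ square bd u v = Some pc /\ dir pc du dv /\
    square bd (u + du) (v + dv) = None.
Proof.
  intros D (pc & dx & dy & H1 & H2 & H3 & _).
  destruct (dark_uv _ _ _ _ D H1) as (u & v & -> & ->).
  destruct (permitted_uv _ _ _ H2) as (du & dv & -> & -> & P).
  exists u, v, pc, du, dv. unfold square. repeat split; auto. rewrite <- H3. f_equal; lia.
Qed.

(** * The filled board *)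

Definition kingsq (p : positive) (x y : Z) : Prop := far p /\ x = vcol p + 4 /\ y = vstart p.
Definition pawnsq (p : positive) (x y : Z) : Prop := far p /\ x = vcol p + 2 /\ y = vstart p.

Lemma kingsq_guard p x y : kingsq p x y -> guard p x y.
Proof. unfold kingsq, guard. lia. Qed.
Lemma pawnsq_guard p x y : pawnsq p x y -> guard p x y.
Proof. unfold pawnsq, guard. lia. Qed.
Lemma kingsq_touches p x y : kingsq p x y -> touches p x y.
Proof. intros (F & -> & ->). right. split; auto. lia. Qed.
Lemma pawnsq_touches p x y : pawnsq p x y -> touches p x y.
Proof. intros (F & -> & ->). right. split; auto. lia. Qed.

(** [lab] marks the nodes that are not leaves. The order of the tests is immaterial, since the
    special squares turn out to be disjoint. *)
Definition board0 (lab : positive -> Prop) (x y : Z) : option piece :=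
  if excluded_middle_informative (empty_sq x y) then None
  else if excluded_middle_informative (exists p, kingsq p x y /\ lab p) then Some BK
  else if excluded_middle_informative (exists p, pawnsq p x y) then Some BP
  else Some RP.

Section board0.
Context (lab : positive -> Prop).

Lemma board0_empty x y : empty_sq x y -> board0 lab x y = None.
Proof. unfold board0. intros. destruct excluded_middle_informative; tauto. Qed.

Lemma board0_occupied x y : ~ empty_sq x y -> board0 lab x y <> None.
Proof. unfold board0. intros. repeat destruct excluded_middle_informative; easy. Qed.

Lemma board0_RP x y : ~ empty_sq x y -> (forall p, ~ kingsq p x y) -> (forall p, ~ pawnsq p x y) ->
  board0 lab x y = Some RP.
Proof.
  unfold board0. intros E K D.
  destruct excluded_middle_informative as [|_]; [easy|].
  destruct excluded_middle_informative as [(p & Kp & _)|_]; [now elim (K p)|].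
  destruct excluded_middle_informative as [(p & Dp)|_]; [now elim (D p)|easy].
Qed.

Lemma board0_BK p x y : lab p -> kingsq p x y -> board0 lab x y = Some BK.
Proof.
  intros L K. unfold board0. destruct excluded_middle_informative as [E|_].
  - exfalso. exact (guard_not_empty p x y (proj1 K) (kingsq_guard _ _ _ K) E).
  - destruct excluded_middle_informative; firstorder.
Qed.

Lemma board0_BP p x y : pawnsq p x y -> board0 lab x y = Some BP.
Proof.
  intros D. unfold board0. destruct excluded_middle_informative as [E|_].
  - exfalso. exact (guard_not_empty p x y (proj1 D) (pawnsq_guard _ _ _ D) E).
  - destruct excluded_middle_informative as [(q & K & _)|_].
    + pose proof (guard_touches p q x y (proj1 D) (pawnsq_guard _ _ _ D) (kingsq_touches _ _ _ K)).
      subst q. unfold pawnsq, kingsq in *. lia.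
    + destruct excluded_middle_informative; firstorder.
Qed.

Lemma board0_black x y pc : board0 lab x y = Some pc -> pcolor pc = Black ->
  (exists p, kingsq p x y /\ lab p /\ pc = BK) \/ (exists p, pawnsq p x y /\ pc = BP).
Proof.
  unfold board0. destruct excluded_middle_informative as [|_]; [easy|].
  destruct excluded_middle_informative as [(p & K & L)|_]; [intros [= <-] _; eauto|].
  destruct excluded_middle_informative as [(p & D)|_]; intros [= <-]; [eauto|easy].
Qed.

Lemma board0_red x y pc : board0 lab x y = Some pc -> pcolor pc = Red -> pc = RP.
Proof. unfold board0. repeat destruct excluded_middle_informative; intros [= <-]; cbn; easy. Qed.

Lemma board0_clear x y : clear_area x y -> board0 lab x y = Some RP.
Proof.
  intros [Hx T]. apply board0_RP.
  - intros [[? ?]|[p V]]; [lia|]. exact (T p (vacant_touches _ _ _ V)).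
  - intros p K. exact (T p (kingsq_touches _ _ _ K)).
  - intros p K. exact (T p (pawnsq_touches _ _ _ K)).
Qed.
End board0.

(** * Nodes already visited, and black pieces that cannot move *)

Inductive prefix (p : positive) : positive -> Prop :=
| prefix_refl : prefix p p
| prefix_O q : prefix p q -> prefix p (xO q)
| prefix_I q : prefix p q -> prefix p (xI q).

Lemma prefix_le p q : prefix p q -> p = q \/ 2 * Zpos p <= Zpos q.
Proof. induction 1 as [|q _ [->|IH]|q _ [->|IH]]; auto; lia. Qed.

(** The nodes whose tracks the king of [m] can follow before it turns off towards a child. *)
Inductive chain (m : positive) : positive -> Prop :=
| chain_refl : chain m m
| chain_I n : chain m n -> chain m (xI n).

Lemma chain_prefix m n : chain m n -> prefix m n.
Proof. induction 1; constructor; auto. Qed.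

Lemma chain_far m n : chain m n -> far n -> n = m.
Proof. destruct 1; easy. Qed.

Lemma prefix_chain_far m n p : chain m n -> far p -> prefix p n -> prefix p m.
Proof.
  induction 1 as [|n _ IH]; auto. intros F A. apply IH; auto.
  inversion A; subst; auto. easy.
Qed.

(* The squares that may differ from [board0] once the king of [m] is on the move. *)
Definition spoiled (m : positive) (x y : Z) : Prop :=
  gadget m x y \/ exists n, prefix n m /\ n <> m /\ touches n x y.

(** Of the nodes adjacent to [n], only its parent can be a proper prefix of [m], and then
    [n = m]. *)
Lemma spoiled_near m n x y : far m -> chain m n -> zone n x y -> spoiled m x y ->
  gadget m x y \/ (n = m /\ exists q, m = xO q /\ touches q x y).
Proof.
  intros F C Zn [E|(q & A & Q & T)]; auto. right.
  apply prefix_le in A. destruct A as [A|A]; [easy|].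
  assert (A' := prefix_le _ _ (chain_prefix _ _ C)).
  destruct (zone_sep n q x y Zn (touches_zone _ _ _ T)) as [->|[->|[->|[->| ->]]]].
  - lia.
  - destruct A' as [->|A']; [|lia]. split; eauto.
  - destruct A' as [->|A']; [easy|lia].
  - lia.
  - lia.
Qed.

Definition intact (bd : board) (p : positive) : Prop :=
  forall x y, guard p x y -> square bd x y <> None.

(** On the pawn square the piece has to be [BP]: [guard] omits [(vcol p, vstart p)], where a king
    capturing to the left would land. *)
Definition still (bd : board) (x y : Z) (pc : piece) : Prop :=
  exists p, far p /\ intact bd p /\ (kingsq p x y \/ pawnsq p x y /\ pc = BP).

Lemma still_blocked bd x y pc du dv : still bd x y pc -> dir pc du dv ->
  square bd (x + du) (y + dv) <> None /\ square bd (x + 2 * du) (y + 2 * dv) <> None.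
Proof.
  intros (p & F & I & [(_ & -> & ->)|[(_ & -> & ->) ->]]) D.
  - apply dir_nz in D. split; apply I; unfold guard; lia.
  - unfold dir in D; cbn in D. split; apply I; unfold guard; lia.
Qed.

Lemma still_safe bd x y pc : still bd x y pc ->
  square bd (x - 1) y <> None /\ square bd x (y - 1) <> None.
Proof.
  intros (p & F & I & [(_ & -> & ->)|[(_ & -> & ->) ->]]); split; apply I; unfold guard; lia.
Qed.

(** [C] is any set containing the squares changed so far. *)
Lemma still_intro lab bd p x y pc (C : Z -> Z -> Prop) :
  (forall x y, ~ C x y -> square bd x y = board0 lab x y) -> far p ->
  (forall x y, guard p x y -> ~ C x y) ->
  kingsq p x y \/ pawnsq p x y -> square bd x y = Some pc -> still bd x y pc.
Proof.
  intros A F G K E. exists p. split; [auto|split].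
  - intros s t Hg. rewrite A by auto. apply board0_occupied, (guard_not_empty p); auto.
  - destruct K as [K|K]; auto. right. split; auto.
    rewrite A in E by (apply G, pawnsq_guard, K). rewrite (board0_BP lab p) in E by auto. congruence.
Qed.

Lemma stuck_black p : pturn p = Black -> dark (pboard p) ->
  (forall x y pc, square (pboard p) x y = Some pc -> pcolor pc = Black -> still (pboard p) x y pc) ->
  ~ exists q, move p q.
Proof.
  intros T D S [q (_ & HJ & HS)]. rewrite T in *.
  assert (NJ : ~ has_jump Black (pboard p)).
  { intros J. apply has_jump_inv in J as (x & y & du & dv & pc & Hc & H1 & H2 & _ & H3); auto.
    destruct (still_blocked _ _ _ _ _ _ (S _ _ _ H1 Hc) H2); auto. }
  destruct (HS NJ) as (x & y & pc & H1 & Hc & H2).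
  apply simple_step_inv in H2 as (u & v & pc' & du & dv & -> & -> & H2 & H3 & H4); auto.
  assert (pc' = pc) as -> by (unfold square in H2; congruence).
  destruct (still_blocked _ _ _ _ _ _ (S _ _ _ H2 Hc) H3); auto.
Qed.

(* Lets [lia] reason about [/ 2] and [mod 2]. *)
Ltac Zify.zify_post_hook ::= Z.to_euclidean_division_equations.

(** * The walk of a king *)

(** The corner at the top of a column counts as [OnRow], so that each square of a walk has one
    description. *)
Inductive place := AtKing | AtPawn | OnColumn (y : Z) | OnRow (x : Z) | AtGate | AtEnd.

Definition place_x (n : positive) (h : place) : Z :=
  match h with
  | AtKing => vcol n + 4 | AtPawn => vcol n + 2 | OnColumn _ => vcol n | OnRow x => x | AtGate => hend n | AtEnd => hend n - 2
  end.
Definition place_y (n : positive) (h : place) : Z :=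
  match h with AtKing | AtPawn => vstart n | OnColumn y => y | OnRow _ => hrow n | AtGate | AtEnd => hrow n + 2 end.

(** At [OnRow (vcol (xI n))] both [hop_H] and [hop_I] apply: this is the only fork. *)
Inductive hop (m : positive) :
  positive -> place -> Z -> Z -> positive -> place -> Prop :=
| hop_K : hop m m AtKing (-1) 0 m AtPawn
| hop_D : hop m m AtPawn (-1) 0 m (OnColumn (vstart m))
| hop_V n y : y + 2 < hrow n -> hop m n (OnColumn y) 0 1 n (OnColumn (y + 2))
| hop_C n y : y + 2 = hrow n -> hop m n (OnColumn y) 0 1 n (OnRow (vcol n))
| hop_H n x : hend n < x -> hop m n (OnRow x) (-1) 0 n (OnRow (x - 2))
| hop_I n : hop m n (OnRow (vcol (xI n))) 0 1 (xI n) (OnColumn (hrow n + 2))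
| hop_E n : hop m n (OnRow (hend n)) 0 1 n AtGate
| hop_L n : hop m n AtGate (-1) 0 n AtEnd.

Inductive walk (m : positive) : positive -> place -> list (Z * Z) -> Prop :=
| walk_K : walk m m AtKing []
| walk_hop n h l du dv n' h' : walk m n h l -> hop m n h du dv n' h' ->
    walk m n' h' ((place_x n h + du, place_y n h + dv) :: l).

(** Besides the range of the coordinates, this records that the square just behind the king has been
    captured; being empty, it rules out a jump back. *)
Definition valid (m n : positive) (h : place) (l : list (Z * Z)) : Prop :=
  chain m n /\
  match h with
  | AtKing => n = m
  | AtPawn => n = m /\ In (vcol m + 3, vstart m) l
  | OnColumn y => (hrow n - y) mod 2 = 0 /\ y < hrow n /\
     (n = m /\ y = vstart m /\ In (vcol n + 1, y) l \/ vstart n + 2 <= y /\ In (vcol n, y - 1) l)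
  | OnRow x => hend n <= x /\ (vcol n - x) mod 2 = 0 /\
     (x = vcol n /\ In (vcol n, hrow n - 1) l \/ x < vcol n /\ In (x + 1, hrow n) l)
  | AtGate => In (hend n, hrow n + 1) l
  | AtEnd => In (hend n - 1, hrow n + 2) l
  end.

Ltac ineq := match goal with |- In ?a (?b :: _) => left; f_equal; cbn [place_x place_y]; coords; lia end.

Lemma walk_valid m n h l : far m -> walk m n h l -> valid m n h l.
Proof.
  intros F. induction 1 as [|n h l du dv n' h' _ [C V] N].
  - split; constructor.
  - destruct m as [m|m|]; try easy. clear F.
    destruct N; cbn beta iota in V; (split; [auto using chain|]); cbn [place_x place_y].
    + split; auto. ineq.
    + split; [coords; lia|]. split; [coords; lia|]. left. repeat split. ineq.
    + destruct V as (V1 & V2 & V). split; [coords; lia|]. split; [coords; lia|]. right. split; [|ineq].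
      destruct V as [(-> & -> & _)|[V _]]; lia.
    + split; [coords; lia|]. split; [coords; lia|]. left. split; auto. ineq.
    + destruct V as (V1 & V2 & V). split; [coords; lia|]. split; [coords; lia|].
      right. split; [lia|ineq].
    + split; [coords; lia|]. split; [coords; lia|]. right. split; [coords; lia|ineq].
    + ineq.
    + ineq.
Qed.

Definition in_range (m n : positive) (h : place) : Prop :=
  match h with
  | AtKing | AtPawn => n = m
  | OnColumn y => (hrow n - y) mod 2 = 0 /\ vstart n <= y < hrow n
  | OnRow x => (vcol n - x) mod 2 = 0 /\ hend n <= x <= vcol n
  | _ => True
  end.

Lemma walk_range m n h l : far m -> walk m n h l -> chain m n /\ in_range m n h.
Proof.
  intros F T. destruct (walk_valid _ _ _ _ F T) as [C V]. split; [exact C|].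
  destruct h; cbn beta iota delta [in_range] in *; try tauto.
  - destruct V as (V1 & V2 & [(-> & -> & _)|[V3 _]]); lia.
  - destruct V as (V1 & V2 & [[-> _]|[V3 _]]); [coords|]; lia.
Qed.

Lemma hop_dir m n h du dv n' h' : hop m n h du dv n' h' ->
  (du = -1 /\ dv = 0 \/ du = 0 /\ dv = 1) /\
  place_x n' h' = place_x n h + 2 * du /\ place_y n' h' = place_y n h + 2 * dv.
Proof. destruct 1; cbn [place_x place_y]; coords; lia. Qed.

Lemma hop_chain m q n h du dv n' h' : chain q n -> hop m n h du dv n' h' -> chain q n'.
Proof. destruct 2; auto using chain. Qed.

(** Hops lead only left or up, so all captures lie weakly to the right of the king and weakly below
    it, and the squares ahead are untouched. *)
Lemma walk_captured m n h l s t : far m -> walk m n h l -> In (s, t) l ->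
  place_x n h <= s /\ t <= place_y n h /\
  ((exists q, chain m q /\ chain q n /\ track q s t) \/ ((h = AtGate \/ h = AtEnd) /\ gadget (xO n) s t)).
Proof.
  intros F T. induction T as [|n h l du dv n' h' T IH N]; [easy|].
  destruct (walk_range _ _ _ _ F T) as [C V].
  destruct (hop_dir _ _ _ _ _ _ _ N) as (Hd & Hx & Hy).
  intros [E|I].
  - injection E as <- <-. split; [lia|]. split; [lia|].
    destruct m as [m|m|]; try easy.
    clear IH T. destruct N; cbn beta iota delta [in_range place_x place_y] in *.
    + left. exists (xO m). repeat (split; [auto using chain|]). right; right. finish.
    + left. exists (xO m). repeat (split; [auto using chain|]). right; right. finish.
    + left. exists n. repeat (split; [auto using chain|]). right; left. finish.
    + left. exists n. repeat (split; [auto using chain|]). right; left. finish.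
    + left. exists n. repeat (split; [auto using chain|]). left. finish.
    + left. exists (xI n). repeat (split; [auto using chain|]). right; left. finish.
    + right. split; [auto|]. finish.
    + right. split; [auto|]. finish.
  - destruct (IH I) as (H1 & H2 & [(q & H3 & H4 & H5)|[H3 H4]]).
    + split; [lia|]. split; [lia|]. left. exists q. eauto using hop_chain.
    + split; [lia|]. split; [lia|]. right.
      destruct N; destruct H3; try discriminate; auto.
Qed.

(** The invariant when Black is to move. Gadgets at proper prefixes of [m] may be used up; every
    black piece other than the king of [m] belongs to a gadget off that path, which is intact. *)
Record ready (lab : positive -> Prop) (m : positive) (bd : board) : Prop := {
  ready_far : far m;
  ready_dark : dark bd;
  ready_agree : forall x y, ~ spoiled m x y -> square bd x y = board0 lab x y;
  ready_black : forall x y pc, square bd x y = Some pc -> pcolor pc = Black ->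
    kingsq m x y /\ lab m /\ pc = BK \/
    exists p, far p /\ ~ prefix p m /\ (kingsq p x y \/ pawnsq p x y);
  ready_red : forall x y pc, square bd x y = Some pc -> pcolor pc = Red -> pc = RP;
  ready_gone : square bd (vcol m + 2) (vstart m) = None;
  ready_king : lab m -> square bd (vcol m + 4) (vstart m) = Some BK
}.

(* The configuration after the walk from the king of [m] on board [bd] to place [h] of node [n],
   [l] being the captured squares. *)
Record walking (m : positive) (bd : board) (n : positive) (h : place) (l : list (Z * Z))
  (k : conf) : Prop := {
  ok_dark : dark (cboard k);
  ok_cx : cx k = place_x n h - place_y n h;
  ok_cy : cy k = place_x n h + place_y n h;
  ok_king : square (cboard k) (place_x n h) (place_y n h) = Some BK;
  ok_here : kingsq m (place_x n h) (place_y n h) \/ square bd (place_x n h) (place_y n h) = None;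
  ok_captured : forall s t, ~ (s = place_x n h /\ t = place_y n h) -> In (s, t) l \/ kingsq m s t ->
    square (cboard k) s t = None;
  ok_same : forall s t, ~ (s = place_x n h /\ t = place_y n h) -> ~ In (s, t) l -> ~ kingsq m s t ->
    square (cboard k) s t = square bd s t
}.

Lemma pair_dec (s t a b : Z) : s = a /\ t = b \/ ~ (s = a /\ t = b).
Proof. lia. Qed.

Lemma walking_jump m bd n h l k du dv n' h' k' : far m -> walk m n h l ->
  walking m bd n h l k -> hop m n h du dv n' h' ->
  square (cboard k) (place_x n h + 2 * du) (place_y n h + 2 * dv) = None ->
  jumped (cboard k) (cboard k') (place_x n h) (place_y n h) du dv BK ->
  cx k' = place_x n h + 2 * du - (place_y n h + 2 * dv) ->
  cy k' = place_x n h + 2 * du + (place_y n h + 2 * dv) ->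
  walking m bd n' h' ((place_x n h + du, place_y n h + dv) :: l) k'.
Proof.
  intros F T OK N E (D & J1 & J2 & J3 & J4) Ex Ey.
  destruct (hop_dir _ _ _ _ _ _ _ N) as (Hd & Hx & Hy).
  constructor; auto; rewrite ?Hx, ?Hy; auto.
  - destruct (excluded_middle_informative (kingsq m (place_x n h + 2 * du) (place_y n h + 2 * dv))); auto.
    right. rewrite <- (ok_same _ _ _ _ _ _ OK); auto; [lia|].
    intros I. destruct (walk_captured _ _ _ _ _ _ F T I). lia.
  - intros s t H1 H2.
    destruct (pair_dec s t (place_x n h + du) (place_y n h + dv)) as [[-> ->]|H3]; [auto|].
    destruct (pair_dec s t (place_x n h) (place_y n h)) as [[-> ->]|H4]; [auto|].
    rewrite J4 by auto. apply (ok_captured _ _ _ _ _ _ OK); auto.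
    destruct H2 as [[[= H2 H5]|H2]|H2]; auto. lia.
  - intros s t H1 H2 H3.
    assert (~ (s = place_x n h + du /\ t = place_y n h + dv)).
    { intros [-> ->]. apply H2. left. reflexivity. }
    assert (~ In (s, t) l) by (intros I; apply H2; right; exact I).
    destruct (pair_dec s t (place_x n h) (place_y n h)) as [[-> ->]|H4].
    + destruct (ok_here _ _ _ _ _ _ OK); [easy|]. congruence.
    + rewrite J4 by auto. apply (ok_same _ _ _ _ _ _ OK); auto.
Qed.

Lemma clear_occupied lab m bd n h l k s t : ready lab m bd -> walk m n h l -> walking m bd n h l k ->
  clear_area s t -> ~ (s = place_x n h /\ t = place_y n h) -> square (cboard k) s t = Some RP.
Proof.
  intros I T OK [Hx Cl] Hne.
  rewrite (ok_same _ _ _ _ _ _ OK); auto.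
  - rewrite (ready_agree _ _ _ I); [apply board0_clear; split; auto|].
    intros [E|(q & _ & _ & E)]; [|exact (Cl q E)]. apply (Cl m). right. exact E.
  - intros In. destruct (walk_captured _ _ _ _ _ _ (ready_far _ _ _ I) T In) as (_ & _ & [(q & _ & _ & E)|[_ E]]).
    + apply (Cl q). left. exact E.
    + apply (Cl (xO n)). right. exact E.
  - intros K. exact (Cl m (kingsq_touches _ _ _ K)).
Qed.

(** In every place, a direction that is not a hop fails for one of two reasons: the square to be
    jumped was emptied by the previous capture ([NI]), or the landing square is clear of tracks and
    thus occupied ([NC]). *)
Lemma only_hop lab m bd n h l k du dv e : ready lab m bd -> walk m n h l -> walking m bd n h l k ->
  dir BK du dv -> square (cboard k) (place_x n h + du) (place_y n h + dv) = Some e ->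
  square (cboard k) (place_x n h + 2 * du) (place_y n h + 2 * dv) = None ->
  exists n' h', hop m n h du dv n' h'.
Proof.
  intros I T OK D Em Et.
  pose proof (ready_far _ _ _ I) as F.
  destruct (walk_valid _ _ _ _ F T) as [C V].
  assert (NC : clear_area (place_x n h + 2 * du) (place_y n h + 2 * dv) -> False).
  { intros Cl. apply dir_nz in D.
    rewrite (clear_occupied lab m bd n h l k) in Et; auto; [discriminate|lia]. }
  assert (NI : forall s t, In (s, t) l -> s = place_x n h + du -> t = place_y n h + dv -> False).
  { intros s t In -> ->. apply dir_nz in D.
    rewrite (ok_captured _ _ _ _ _ _ OK) in Em; auto; [discriminate|lia]. }
  apply dir_nz in D.
  destruct h; cbn [place_x place_y valid] in *.
  - subst n. assert (D' : du = -1 /\ dv = 0 \/ ~ (du = -1 /\ dv = 0)) by lia.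
    destruct D' as [[-> ->]|D']; [eauto using hop|].
    destruct NC. apply (clear_gadget m); auto. lia.
  - destruct V as [-> V]. assert (D' : du = -1 /\ dv = 0 \/ du = 1 /\ dv = 0 \/ du = 0) by lia.
    destruct D' as [[-> ->]|[[-> ->]|D']]; [eauto using hop| |].
    + destruct (NI _ _ V); lia.
    + destruct NC. apply (clear_gadget m); auto. lia.
  - destruct V as (P & L & V).
    assert (D' : du = 0 /\ dv = 1 \/ du = 0 /\ dv = -1 \/ du = -1 /\ dv = 0 \/ du = 1 /\ dv = 0) by lia.
    destruct D' as [[-> ->]|[[-> ->]|[[-> ->]|[-> ->]]]].
    + assert (E : y + 2 < hrow n \/ y + 2 = hrow n) by lia. destruct E; eauto using hop.
    + destruct V as [(-> & -> & _)|[_ V]].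
      * destruct NC. replace (vcol m + 2 * 0) with (vcol m) by lia.
        replace (vstart m + 2 * -1) with (vstart m - 2) by lia. apply clear_ver_down; auto.
      * destruct (NI _ _ V); lia.
    + destruct NC. replace (vcol n + 2 * -1) with (vcol n - 2) by lia.
      replace (y + 2 * 0) with y by lia. apply clear_ver_left.
      destruct V as [(-> & -> & _)|[V _]]; [auto|lia].
    + destruct V as [(-> & -> & V)|[V _]].
      * destruct (NI _ _ V); lia.
      * destruct NC. replace (vcol n + 2 * 1) with (vcol n + 2) by lia.
        replace (y + 2 * 0) with y by lia. apply clear_ver_right. lia.
  - destruct V as (L & P & V).
    assert (D' : du = -1 /\ dv = 0 \/ du = 0 /\ dv = 1 \/ du = 0 /\ dv = -1 \/ du = 1 /\ dv = 0) by lia.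
    destruct D' as [[-> ->]|[[-> ->]|[[-> ->]|[-> ->]]]].
    + assert (E : hend n < x \/ x = hend n) by lia. destruct E as [E| ->]; eauto using hop.
      destruct NC. replace (hend n + 2 * -1) with (hend n - 2) by lia.
      replace (hrow n + 2 * 0) with (hrow n) by lia. apply clear_hor_left.
    + destruct (Z.eq_dec x (hend n)) as [->|Nx]; [eauto using hop|].
      destruct (Z.eq_dec x (vcol (xI n))) as [->|Nx']; [eauto using hop|].
      destruct NC. replace (x + 2 * 0) with x by lia.
      replace (hrow n + 2 * 1) with (hrow n + 2) by lia. apply clear_hor_up; auto. lia.
    + destruct V as [[-> V]|[V _]].
      * destruct (NI _ _ V); lia.
      * destruct NC. replace (x + 2 * 0) with x by lia.
        replace (hrow n + 2 * -1) with (hrow n - 2) by lia. apply clear_hor_down. lia.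
    + destruct V as [[-> _]|[_ V]].
      * destruct NC. replace (hrow n + 2 * 0) with (hrow n) by lia.
        replace (vcol n + 2 * 1) with (vcol n + 2) by lia. apply clear_hor_right.
      * destruct (NI _ _ V); lia.
  - assert (D' : du = -1 /\ dv = 0 \/ du = 0 /\ dv = -1 \/ (du = 1 /\ dv = 0 \/ du = 0 /\ dv = 1)) by lia.
    destruct D' as [[-> ->]|[[-> ->]|D']]; [eauto using hop| |].
    + destruct (NI _ _ V); lia.
    + destruct NC. apply (clear_gadget (xO n)); [easy|]. coords; lia.
  - assert (D' : du = 1 /\ dv = 0 \/ (du = -1 /\ dv = 0 \/ du = 0 /\ (dv = 1 \/ dv = -1))) by lia.
    destruct D' as [[-> ->]|D'].
    + destruct (NI _ _ V); lia.
    + destruct NC. apply (clear_gadget (xO n)); [easy|]. coords; lia.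
Qed.

Lemma hop_mid_zone m n h du dv n' h' : in_range m n h ->
  hop m n h du dv n' h' -> far m -> zone n (place_x n h + du) (place_y n h + dv).
Proof.
  intros V N F. destruct m as [m|m|]; try easy.
  destruct N; cbn beta iota delta [in_range place_x place_y] in *; finish.
Qed.

Lemma hop_mid_fresh m n h du dv n' h' : far m -> chain m n -> in_range m n h ->
  hop m n h du dv n' h' -> ~ spoiled m (place_x n h + du) (place_y n h + dv).
Proof.
  intros F C V N Hc.
  pose proof (prefix_le _ _ (chain_prefix _ _ C)) as A.
  apply (spoiled_near m n) in Hc; auto; [|eapply hop_mid_zone; eauto].
  destruct Hc as [E|[-> (q & -> & T)]].
  - assert (T : touches m (place_x n h + du) (place_y n h + dv)) by (right; exact E).
    destruct m as [m|m|]; try easy. clear C.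
    destruct N; cbn beta iota delta [in_range place_x place_y] in *.
    + finish.
    + finish.
    + near n T; finish.
    + near n T; finish.
    + near n T; finish.
    + near n T; finish.
    + near n T; finish.
    + near n T; finish.
  - clear C A.
    inversion N; subst; cbn beta iota delta [in_range place_x place_y] in *; finish.
Qed.

(** Together with [hop_mid_fresh] this leaves only a red pawn on the square to be captured. *)
Lemma hop_mid_special m n h du dv n' h' q : far m -> in_range m n h ->
  hop m n h du dv n' h' ->
  ~ vacant q (place_x n h + du) (place_y n h + dv) /\ ~ kingsq q (place_x n h + du) (place_y n h + dv) /\
  ~ pawnsq q (place_x n h + du) (place_y n h + dv).
Proof.
  intros F V N.
  assert (H : touches q (place_x n h + du) (place_y n h + dv) ->
     vacant q (place_x n h + du) (place_y n h + dv) \/ kingsq q (place_x n h + du) (place_y n h + dv) \/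
     pawnsq q (place_x n h + du) (place_y n h + dv) -> False).
  { intros T. assert (Zn := hop_mid_zone _ _ _ _ _ _ _ V N F).
    destruct (zone_sep _ _ _ _ Zn (touches_zone _ _ _ T)) as [E|E]; clear Zn T;
      destruct m as [m|m|]; try easy;
      destruct N; cbn beta iota delta [in_range place_x place_y] in *;
      (destruct E as [E|[E|[E|E]]] || idtac); try discriminate;
      try (injection E as E); subst; unfold kingsq, pawnsq;
      intros [G|[G|G]]; finish. }
  split; [|split]; intros K; apply H; auto using vacant_touches, kingsq_touches, pawnsq_touches.
Qed.

(** The pawn square of [m] is the exception: it is occupied on [board0] and empty only by
    [ready_gone]. *)
Lemma hop_target m n h du dv n' h' : far m -> chain m n -> in_range m n h ->
  hop m n h du dv n' h' ->
  h' = AtPawn /\ n' = m \/ ~ spoiled m (place_x n' h') (place_y n' h') /\ empty_sq (place_x n' h') (place_y n' h').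
Proof.
  intros F C V N. destruct m as [m|m|]; try easy.
  assert (D : h' = AtPawn \/ h' <> AtPawn) by (destruct h'; auto; right; discriminate).
  destruct D as [D|D]; [left; destruct N; easy|right]. split.
  - intros Hc.
    pose proof (prefix_le _ _ (chain_prefix _ _ C)) as A.
    assert (Zn : zone n (place_x n' h') (place_y n' h')).
    { destruct N; cbn beta iota delta [in_range place_x place_y] in *; finish. }
    apply (spoiled_near (xO m) n) in Hc; auto.
    destruct Hc as [E|[-> (q & [= <-] & T)]].
    + assert (T : touches (xO m) (place_x n' h') (place_y n' h')) by (right; exact E).
      clear C Zn.
      destruct N; cbn beta iota delta [in_range place_x place_y] in *; try easy; [finish|near n T; finish..].
    + clear C A Zn.
      inversion N; subst; cbn beta iota delta [in_range place_x place_y] in *; try easy; finish.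
  - right. destruct N; cbn beta iota delta [in_range place_x place_y] in *; try easy.
    + exists (xO m). finish.
    + exists n. left. split; [right|]; finish.
    + exists n. left. split; [right|]; finish.
    + exists n. left. split; [left|]; finish.
    + exists (xI n). left. split; [right|]; finish.
    + exists (xO n). right. finish.
    + exists (xO n). right. finish.
Qed.

Lemma hop_can_jump lab m bd n h l k du dv n' h' :
  ready lab m bd -> walk m n h l -> walking m bd n h l k -> hop m n h du dv n' h' ->
  can_jump (cboard k) (place_x n h) (place_y n h) du dv BK.
Proof.
  intros I T OK N. pose proof (ready_far _ _ _ I) as F.
  destruct (walk_range _ _ _ _ F T) as [C V].
  destruct (hop_dir _ _ _ _ _ _ _ N) as (Hd & Hx & Hy).
  assert (NI : forall s t, s < place_x n h \/ place_y n h < t -> ~ In (s, t) l).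
  { intros s t Hst In. destruct (walk_captured _ _ _ _ _ _ F T In). lia. }
  split; [apply (ok_king _ _ _ _ _ _ OK)|]. split; [unfold dir; cbn; lia|]. split.
  - exists RP. split; [|easy].
    rewrite (ok_same _ _ _ _ _ _ OK); [|lia|apply NI; lia|].
    + rewrite (ready_agree _ _ _ I) by (eapply hop_mid_fresh; eauto).
      apply board0_RP; [|intros q; apply (hop_mid_special m n h du dv n' h' q); auto..].
      intros [[E1 E2]|[q Hq]].
      * assert (Zn := hop_mid_zone _ _ _ _ _ _ _ V N F). rewrite E1, E2 in Zn.
        clear - Zn. destruct n; finish.
      * apply (hop_mid_special m n h du dv n' h' q) in Hq; auto.
    + apply (hop_mid_special m n h du dv n' h' m); auto.
  - destruct (excluded_middle_informative (kingsq m (place_x n h + 2 * du) (place_y n h + 2 * dv))) as [K|K].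
    + apply (ok_captured _ _ _ _ _ _ OK); auto. lia.
    + rewrite (ok_same _ _ _ _ _ _ OK); auto; [|lia|apply NI; lia].
      rewrite <- Hx, <- Hy.
      destruct (hop_target _ _ _ _ _ _ _ F C V N) as [[-> ->]|[Hc He]].
      * apply (ready_gone _ _ _ I).
      * rewrite (ready_agree _ _ _ I) by auto. apply board0_empty; auto.
Qed.

(** * The iterated jumps of the king are exactly the walks *)

Lemma walk_fwd lab m bd n h l k du dv n' h' :
  ready lab m bd -> walk m n h l -> walking m bd n h l k -> hop m n h du dv n' h' ->
  exists k', jstep k k' /\ walking m bd n' h' ((place_x n h + du, place_y n h + dv) :: l) k'.
Proof.
  intros I T OK N.
  pose proof (hop_can_jump _ _ _ _ _ _ _ _ _ _ _ I T OK N) as J.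
  destruct (jstep_intro k _ _ _ _ _ (ok_dark _ _ _ _ _ _ OK) (ok_cx _ _ _ _ _ _ OK)
    (ok_cy _ _ _ _ _ _ OK) J) as (k' & S & H & Ex & Ey).
  exists k'. split; auto. eapply walking_jump; eauto; [apply (ready_far _ _ _ I)|apply J].
Qed.

Lemma walk_back lab m bd n h l k k' :
  ready lab m bd -> walk m n h l -> walking m bd n h l k -> jstep k k' ->
  exists du dv n' h', hop m n h du dv n' h' /\
    walking m bd n' h' ((place_x n h + du, place_y n h + dv) :: l) k'.
Proof.
  intros I T OK S.
  destruct (jstep_inv _ _ _ _ (ok_dark _ _ _ _ _ _ OK) (ok_cx _ _ _ _ _ _ OK)
    (ok_cy _ _ _ _ _ _ OK) S) as (pc & du & dv & J & H & Ex & Ey).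
  destruct J as (J1 & J2 & (e & J3 & J4) & J5).
  rewrite (ok_king _ _ _ _ _ _ OK) in J1. injection J1 as <-.
  destruct (only_hop _ _ _ _ _ _ _ _ _ _ I T OK J2 J3 J5) as (n' & h' & N).
  exists du, dv, n', h'. split; auto.
  eapply walking_jump; eauto. apply (ready_far _ _ _ I).
Qed.

Definition start (m : positive) (bd : board) : conf :=
  mkConf bd (vcol m + 4 - vstart m) (vcol m + 4 + vstart m).

Lemma start_walking lab m bd : ready lab m bd -> lab m -> walking m bd m AtKing [] (start m bd).
Proof.
  intros I L. constructor; auto.
  - apply (ready_dark _ _ _ I).
  - apply (ready_king _ _ _ I L).
  - left. split; [apply (ready_far _ _ _ I)|auto].
  - intros s t H [[]|(_ & -> & ->)]. now elim H.
Qed.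

(** [clos_trans] has no empty sequence, hence the separate case [AtKing]. Its last clause is an
    equality of configurations because the first [jstep] must start from [start m bd] itself. *)
Lemma walk_reached lab m bd n h l : ready lab m bd -> lab m -> walk m n h l ->
  exists k, (h = AtKing \/ clos_trans conf jstep (start m bd) k) /\ walking m bd n h l k /\
    (h = AtKing -> k = start m bd).
Proof.
  intros I L. induction 1 as [|n h l du dv n' h' T (k & H & OK & E) N].
  - exists (start m bd). split; auto. split; auto. eapply start_walking; eauto.
  - destruct (walk_fwd _ _ _ _ _ _ _ _ _ _ _ I T OK N) as (k' & S & OK').
    exists k'. split; [right|split; auto].
    + destruct H as [H|H].
      * rewrite <- E by auto. apply t_step, S.
      * eapply t_trans; [exact H|apply t_step, S].
    + intros ->. inversion N.
Qed.

Lemma reached_walk lab m bd k : ready lab m bd -> lab m -> clos_trans conf jstep (start m bd) k ->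
  exists n h l, walk m n h l /\ walking m bd n h l k.
Proof.
  intros I L R. apply clos_trans_tn1_iff in R.
  assert (W : forall n h l k k', walk m n h l -> walking m bd n h l k -> jstep k k' ->
     exists n h l, walk m n h l /\ walking m bd n h l k').
  { intros n h l k1 k2 T OK S.
    destruct (walk_back _ _ _ _ _ _ _ _ I T OK S) as (du & dv & n' & h' & N & OK').
    do 3 eexists. split; [econstructor; eauto|exact OK']. }
  induction R as [k S|k k' S R (n & h & l & T & OK)].
  - eapply W; eauto using walk_K, start_walking.
  - eapply W; eauto.
Qed.

(** By the forced-iterated-jump rule, a finite iterated jump can therefore stop only at [AtEnd]. *)
Lemma walk_open m n h l : far m -> walk m n h l -> h = AtEnd \/
  exists du dv n' h', hop m n h du dv n' h'.
Proof.
  intros F T. destruct (walk_range _ _ _ _ F T) as [_ V].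
  destruct h; unfold in_range in V; auto; right.
  - subst. eauto using hop.
  - subst. eauto using hop.
  - assert (H : y + 2 < hrow n \/ y + 2 = hrow n) by lia. destruct H; eauto 6 using hop.
  - assert (H : hend n < x \/ x = hend n) by lia. destruct H as [H| ->]; eauto 6 using hop.
  - eauto 6 using hop.
Qed.

Lemma climb m n y l : walk m n (OnColumn y) l -> y < hrow n -> (hrow n - y) mod 2 = 0 ->
  exists l', walk m n (OnRow (vcol n)) l'.
Proof.
  intros T L P. assert (E : exists i : nat, hrow n - y = 2 * (Z.of_nat i + 1)).
  { exists (Z.to_nat ((hrow n - y) / 2 - 1)). lia. }
  destruct E as [i E]. clear L P. revert y l T E. induction i as [|i IH]; intros y l T E.
  - eexists. eapply walk_hop; [exact T|]. apply hop_C. lia.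
  - eapply (IH (y + 2)); [|lia]. eapply walk_hop; [exact T|]. apply hop_V. lia.
Qed.

Lemma slide m n x l x' : walk m n (OnRow x) l -> hend n <= x' <= x -> (x - x') mod 2 = 0 ->
  exists l', walk m n (OnRow x') l'.
Proof.
  intros T L P. assert (E : exists i : nat, x - x' = 2 * Z.of_nat i).
  { exists (Z.to_nat ((x - x') / 2)). lia. }
  destruct E as [i E]. clear P. revert x l T E L. induction i as [|i IH]; intros x l T E L.
  - replace x' with x by lia. eauto.
  - eapply (IH (x - 2)); try lia. eapply walk_hop; [exact T|]. apply hop_H. lia.
Qed.

Lemma corner_reached m n : far m -> chain m n -> exists l, walk m n (OnRow (vcol n)) l.
Proof.
  intros F. destruct m as [m|m|]; try easy. induction 1 as [|n C [l T]].
  - eapply climb.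
    + eapply walk_hop; [eapply walk_hop; [apply walk_K|apply hop_K]|apply hop_D].
    + coords; lia.
    + coords; lia.
  - destruct (slide _ _ _ _ (vcol (xI n)) T) as [l' T']; [coords; lia..|].
    eapply climb.
    + eapply walk_hop; [exact T'|apply hop_I].
    + coords; lia.
    + coords; lia.
Qed.

Lemma end_reached m n : far m -> chain m n -> exists l, walk m n AtEnd l.
Proof.
  intros F C. destruct (corner_reached m n F C) as [l T].
  destruct (slide _ _ _ _ (hend n) T) as [l' T']; [coords; lia..|].
  eexists. eapply walk_hop; [eapply walk_hop; [exact T'|apply hop_E]|apply hop_L].
Qed.

Lemma end_stuck lab m bd n l k : ready lab m bd -> walk m n AtEnd l -> walking m bd n AtEnd l k ->
  ~ jump_avail k.
Proof.
  intros I T OK [k' S].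
  destruct (walk_back _ _ _ _ _ _ _ _ I T OK S) as (du & dv & n' & h' & N & _). inversion N.
Qed.

Lemma guard_off m p x y : far p -> ~ prefix p m -> guard p x y -> ~ spoiled m x y.
Proof.
  intros F A G [E|(q & Q & _ & T)].
  - apply A. rewrite (guard_touches p m x y F G) by (right; exact E). constructor.
  - apply A. rewrite <- (guard_touches p q x y F G T). exact Q.
Qed.

Lemma ready_still lab m bd x y pc p : ready lab m bd -> square bd x y = Some pc ->
  far p -> ~ prefix p m -> kingsq p x y \/ pawnsq p x y -> still bd x y pc.
Proof.
  intros I E F A K. apply (still_intro lab bd p x y pc (spoiled m)); auto.
  - apply (ready_agree _ _ _ I).
  - intros. eapply guard_off; eauto.
Qed.

Lemma first_jump lab m bd x y k : ready lab m bd -> jstep (mkConf bd x y) k ->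
  (exists pc, bd x y = Some pc /\ pcolor pc = Black) -> mkConf bd x y = start m bd /\ lab m.
Proof.
  intros I S (pc & E & B). pose proof (ready_dark _ _ _ I) as D.
  destruct (dark_uv _ _ _ _ D E) as (u & v & -> & ->).
  destruct (ready_black _ _ _ I u v pc E B) as [((_ & -> & ->) & L & _)|(p & F & A & K)]; auto.
  destruct (jstep_inv (mkConf bd (u - v) (u + v)) k u v) as (pc' & du & dv & J & _); auto.
  destruct J as (J1 & J2 & _ & J3). cbn [cboard] in *.
  assert (pc' = pc) as -> by (unfold square in J1; congruence).
  destruct (still_blocked bd u v pc du dv); auto; [|easy]. eapply ready_still; eauto.
Qed.

Lemma finite_jump_inv lab m bd b' : ready lab m bd -> finite_jump Black bd b' ->
  lab m /\ exists n l k, walk m n AtEnd l /\ walking m bd n AtEnd l k /\ board_eq b' (cboard k).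
Proof.
  intros I (x & y & pc & k & E & B & R & NJ & Eb).
  assert (S : exists k', jstep (mkConf bd x y) k').
  { apply clos_trans_t1n_iff in R. destruct R; eauto. }
  destruct S as [k' S]. destruct (first_jump _ _ _ _ _ _ I S) as [Es L]; eauto.
  split; auto. rewrite Es in R.
  destruct (reached_walk _ _ _ _ I L R) as (n & h & l & T & OK).
  destruct (walk_open m n h l (ready_far _ _ _ I) T) as [->|(du & dv & n' & h' & N)]; [eauto 6|].
  destruct (walk_fwd _ _ _ _ _ _ _ _ _ _ _ I T OK N) as (k1 & S1 & _).
  destruct NJ. exists k1. exact S1.
Qed.

Lemma finite_jump_intro lab m bd n : ready lab m bd -> lab m -> chain m n ->
  exists l k, walk m n AtEnd l /\ walking m bd n AtEnd l k /\ finite_jump Black bd (cboard k).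
Proof.
  intros I L C. pose proof (ready_far _ _ _ I) as F.
  destruct (end_reached m n F C) as [l T].
  destruct (walk_reached _ _ _ _ _ _ I L T) as (k & [?|R] & OK & _); [easy|].
  exists l, k. split; auto. split; auto.
  exists (vcol m + 4 - vstart m), (vcol m + 4 + vstart m), BK, k.
  split; [apply (ready_king _ _ _ I L)|]. split; [auto|]. split; [exact R|].
  split; [eapply end_stuck; eauto|]. intros u w. reflexivity.
Qed.

(** * Infinite jumps *)

Lemma guard_left p x y : far p -> guard p x y -> x < 0.
Proof. intros F G. unfold guard in G. destruct p as [p|p|]; try easy. coords; lia. Qed.

(** No black piece can be captured, so Red may make a simple move; sliding a pawn to [(20, 0)]
    happens far from every guard and leaves Black stuck. *)
Lemma free_move bd : dark bd ->
  (forall x y pc, square bd x y = Some pc -> pcolor pc = Black -> still bd x y pc) ->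
  (forall x y pc, square bd x y = Some pc -> pcolor pc = Red -> pc = RP) ->
  square bd 20 1 = Some RP -> square bd 20 0 = None ->
  exists q, move (mkPos bd Red) q /\ wonRed q.
Proof.
  intros D S R E1 E0.
  exists (mkPos (upd (upd bd (20 - 1) (20 + 1) None) (20 - 0) (20 + 0) (Some RP)) Black).
  split.
  - split; [reflexivity|]. cbn [pturn pboard]. split.
    + intros J. exfalso. apply has_jump_inv in J as (x & y & du & dv & pc & C & J1 & J2 & (e & J3 & J4) & J5); auto.
      rewrite (R _ _ _ J1 C) in *. unfold dir in J2; cbn in J2, J4.
      assert (B : pcolor e = Black) by (destruct (pcolor e); easy).
      destruct (still_safe _ _ _ _ (S _ _ _ J3 B)) as [S1 S2].
      destruct J2 as [[-> ->]|[-> ->]].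
      * apply S1. rewrite <- J5. f_equal; lia.
      * apply S2. rewrite <- J5. f_equal; lia.
    (* The board square [(19, 21)] is [(20, 1)] in diagonal coordinates. *)
    + intros _. exists 19, 21, RP. split; [exact E1|]. split; [reflexivity|].
      exists RP, 1, (-1). split; [exact E1|]. split; [unfold permitted; cbn; lia|]. split; [exact E0|].
      intros u w. reflexivity.
  - split; [reflexivity|]. apply stuck_black; [reflexivity| |]; cbn [pboard].
    + repeat apply dark_upd. exact D.
    + intros x y pc E B. rewrite !square_upd in E.
      destruct (Z.eqb_spec x 20); cbn in E; [subst x; destruct (y =? 0); [injection E as <-; easy|destruct (y =? 1); [easy|]]|].
      * destruct (S _ _ _ E B) as (p & F & _ & [K|[K _]]);
        [apply kingsq_guard in K|apply pawnsq_guard in K]; apply guard_left in K; auto; lia.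
      * destruct (S _ _ _ E B) as (p & F & N & K). exists p. split; auto. split; auto.
        intros s t G. rewrite !square_upd. pose proof (guard_left _ _ _ F G).
        rewrite !eqb_false2 by lia. auto.
Qed.

Definition walked (m : positive) (x y : Z) : Prop :=
  kingsq m x y \/ exists n, chain m n /\ track n x y.

Lemma walked_touches m x y : walked m x y -> exists n, chain m n /\ touches n x y.
Proof.
  intros [K|(n & C & B)].
  - exists m. split; [constructor|]. apply kingsq_touches; auto.
  - exists n. split; auto. left; auto.
Qed.

(** An infinite walk never enters a gate, because the next hop would end at [AtEnd], where no jump
    is possible. So it leaves the gadgets of the children alone. *)
Lemma endless_captured lab m bd f : ready lab m bd -> lab m -> f O = start m bd ->
  (forall i, jstep (f i) (f (S i))) -> forall i x y,
  2 * (x - y) = cx (f i) + cx (f (S i)) -> 2 * (x + y) = cy (f i) + cy (f (S i)) ->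
  exists n, chain m n /\ track n x y.
Proof.
  intros I L E0 St i x y Ex Ey.
  assert (W : forall i, exists n h l, walk m n h l /\ walking m bd n h l (f i)).
  { clear i Ex Ey. intros [|i].
    - rewrite E0. do 3 eexists. split; [apply walk_K|eapply start_walking; eauto].
    - assert (R : clos_trans conf jstep (start m bd) (f (S i))).
      { rewrite <- E0. induction i; [apply t_step|eapply t_trans; [exact IHi|apply t_step]]; apply St. }
      eapply reached_walk; eauto. }
  destruct (W i) as (n & h & l & T & OK).
  destruct (walk_back _ _ _ _ _ _ _ _ I T OK (St i)) as (du & dv & n' & h' & N & OK').
  assert (T' : walk m n' h' ((place_x n h + du, place_y n h + dv) :: l)) by (econstructor; eauto).
  destruct (hop_dir _ _ _ _ _ _ _ N) as (_ & Hx & Hy).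
  pose proof (ok_cx _ _ _ _ _ _ OK). pose proof (ok_cy _ _ _ _ _ _ OK).
  pose proof (ok_cx _ _ _ _ _ _ OK'). pose proof (ok_cy _ _ _ _ _ _ OK').
  assert (x = place_x n h + du) as -> by lia. assert (y = place_y n h + dv) as -> by lia.
  destruct (walk_captured m n' h' _ _ _ (ready_far _ _ _ I) T' (or_introl eq_refl))
    as (_ & _ & [(q & Cq & _ & B)|[P _]]); eauto.
  assert (NL : forall n l j, walk m n AtEnd l -> walking m bd n AtEnd l (f j) -> False).
  { intros n1 l1 j T1 OK1. apply (end_stuck lab m bd n1 l1 (f j)); auto. exists (f (S j)). apply St. }
  destruct P as [-> | ->]; [|exfalso; eapply NL; eauto].
  destruct (walk_back _ _ _ _ _ _ _ _ I T' OK' (St (S i))) as (du2 & dv2 & n2 & h2 & N2 & OK2).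
  inversion N2; subst. exfalso. eapply NL; [|exact OK2]. econstructor; eauto.
Qed.

Lemma infinite_jump_inv lab m bd b' : ready lab m bd -> infinite_jump Black bd b' ->
  lab m /\ dark b' /\ (forall x y, kingsq m x y -> square b' x y = None) /\
  (forall x y, square b' x y = None /\ walked m x y \/ square b' x y = square bd x y).
Proof.
  intros I (x & y & pc & f & E & B & E0 & St & R).
  assert (St0 := St O). rewrite E0 in St0.
  destruct (first_jump _ _ _ _ _ _ I St0) as [Es L]; eauto.
  rewrite Es in E0. injection Es as -> ->. split; auto. cbv zeta in R. split; [|split].
  - intros u w Hd. destruct (R u w) as [R1 R2].
    match type of R1 with ?P -> _ => destruct (excluded_middle_informative P) as [Q|Q] end; auto.
    rewrite R2; auto. apply (ready_dark _ _ _ I); auto.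
  - intros s t (_ & -> & ->). apply R. left. lia.
  - intros s t. destruct (R (s - t) (s + t)) as [R1 R2].
    match type of R1 with ?P -> _ => destruct (excluded_middle_informative P) as [Q|Q] end.
    + left. split; [apply R1; auto|]. destruct Q as [Q|(i & Q1 & Q2)].
      * left. split; [apply (ready_far _ _ _ I)|]. lia.
      * right. eapply endless_captured; eauto.
    + right. apply R2. exact Q.
Qed.

Lemma board_right lab m bd : ready lab m bd -> square bd 20 1 = Some RP /\ square bd 20 0 = None.
Proof.
  intros I.
  assert (T : forall q y, ~ touches q 20 y) by (intros q y T; apply touches_left in T; lia).
  assert (C : forall y, ~ spoiled m 20 y).
  { intros y [E|(q & _ & _ & E)]; [|exact (T q y E)]. apply (T m y). right; auto. }
  rewrite !(ready_agree _ _ _ I) by auto. split.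
  - apply board0_RP.
    + intros [E|[q V]]; [lia|]. apply (T q 1), vacant_touches, V.
    + intros q K. apply (T q 1), kingsq_touches, K.
    + intros q K. apply (T q 1), pawnsq_touches, K.
  - apply board0_empty. left. auto.
Qed.

Lemma endless_reply lab m bd b' : ready lab m bd -> infinite_jump Black bd b' ->
  exists q, move (mkPos b' Red) q /\ wonRed q.
Proof.
  intros I J. destruct (infinite_jump_inv _ _ _ _ I J) as (L & D & K & H).
  assert (Hs : forall x y pc, square b' x y = Some pc -> square bd x y = Some pc).
  { intros x y pc E. destruct (H x y) as [[E' _]|E']; congruence. }
  assert (WL : forall x y, walked m x y -> x < 0).
  { intros x y W. apply walked_touches in W as (n & _ & T). apply touches_left in T. lia. }
  destruct (board_right _ _ _ I) as [R1 R0].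
  apply free_move; auto.
  - intros x y pc E B.
    destruct (ready_black _ _ _ I x y pc (Hs _ _ _ E) B) as [[Kx _]|(p & F & A & Kp)].
    + rewrite K in E by auto. discriminate.
    + apply (still_intro lab b' p x y pc (fun x y => spoiled m x y \/ walked m x y)); auto.
      * intros s t N. destruct (H s t) as [[_ W]|E']; [tauto|].
        rewrite E'. apply (ready_agree _ _ _ I). tauto.
      * intros s t G [C|W]; [exact (guard_off m p s t F A G C)|].
        (* If the walk touched the guard of [p], then [p] would be a far node on the chain, that is
           [m], contrary to [A]. *)
        apply walked_touches in W as (n & C & T).
        apply A. rewrite (guard_touches p n s t F G T) in C. rewrite <- (chain_far m p C F). constructor.
  - intros x y pc E. apply (ready_red _ _ _ I _ _ _ (Hs _ _ _ E)).
  - destruct (H 20 1) as [[_ W]|E]; [apply WL in W; lia|congruence].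
  - destruct (H 20 0) as [[_ W]|E]; [apply WL in W; lia|congruence].
Qed.

(** * The reply of Red *)

(** [trap_stop1] keeps the red pawn from going straight on after its first capture; the other two
    stops end its jump after the second. *)
Record Trap (c : positive) (bd : board) : Prop := {
  trap_dark : dark bd;
  trap_hunter : square bd (vcol c + 2) (vstart c + 1) = Some RP;
  trap_pawn : square bd (vcol c + 2) (vstart c) = Some BP;
  trap_open : square bd (vcol c + 2) (vstart c - 1) = None;
  trap_king : square bd (vcol c + 1) (vstart c - 1) = Some BK;
  trap_land : square bd (vcol c) (vstart c - 1) = None;
  trap_only : forall x y du dv pc, pcolor pc = Red -> can_jump bd x y du dv pc ->
    x = vcol c + 2 /\ y = vstart c + 1 /\ du = 0 /\ dv = -1 /\ pc = RP;
  trap_stop1 : square bd (vcol c + 2) (vstart c - 2) = Some RP;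
  trap_stop2 : square bd (vcol c - 1) (vstart c - 1) = Some RP;
  trap_stop3 : square bd (vcol c) (vstart c - 2) = Some RP
}.

Definition in_trap (c : positive) (x y : Z) : Prop :=
  x = vcol c + 2 /\ vstart c - 1 <= y <= vstart c + 1 \/ y = vstart c - 1 /\ vcol c <= x <= vcol c + 2.

Definition sprung (c : positive) (bd b' : board) : Prop :=
  dark b' /\ square b' (vcol c) (vstart c - 1) = Some RP /\
  (forall x y, in_trap c x y -> ~ (x = vcol c /\ y = vstart c - 1) -> square b' x y = None) /\
  (forall x y, ~ in_trap c x y -> square b' x y = square bd x y).

Definition hunting (c : positive) (bd : board) (k : conf) : Prop :=
  jumped bd (cboard k) (vcol c + 2) (vstart c + 1) 0 (-1) RP /\
  cx k = vcol c + 2 - (vstart c - 1) /\ cy k = vcol c + 2 + (vstart c - 1).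

Definition hunted (c : positive) (bd : board) (k' : conf) : Prop :=
  exists k, hunting c bd k /\ jumped (cboard k) (cboard k') (vcol c + 2) (vstart c - 1) (-1) 0 RP /\
  cx k' = vcol c - (vstart c - 1) /\ cy k' = vcol c + (vstart c - 1).

Lemma square_eq bd x y x' y' v : square bd x y = v -> x = x' -> y = y' -> square bd x' y' = v.
Proof. intros; subst; auto. Qed.

Lemma hunting_can c bd k : Trap c bd -> hunting c bd k ->
  can_jump (cboard k) (vcol c + 2) (vstart c - 1) (-1) 0 RP.
Proof.
  intros T ((D & J1 & J2 & J3 & J4) & Ex & Ey). split; [|split; [|split]].
  - eapply square_eq; [exact J1|lia..].
  - unfold dir; cbn. lia.
  - exists BK. split; [|easy]. rewrite J4 by lia.
    eapply square_eq; [apply (trap_king _ _ T)|lia..].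
  - rewrite J4 by lia. eapply square_eq; [apply (trap_land _ _ T)|lia..].
Qed.

Lemma hunting_step c bd k k' : Trap c bd -> hunting c bd k -> jstep k k' -> hunted c bd k'.
Proof.
  intros T Hk S. exists k. split; auto.
  pose proof (hunting_can _ _ _ T Hk) as (C & _).
  destruct Hk as ((D & J1 & J2 & J3 & J4) & Ex & Ey).
  destruct (jstep_inv k k' (vcol c + 2) (vstart c - 1)) as (pc & du & dv & J & H & Ex' & Ey'); auto.
  destruct J as (K1 & K2 & (e & K3 & K4) & K5).
  assert (pc = RP) as -> by congruence. unfold dir in K2; cbn in K2, K4.
  destruct K2 as [[-> ->]|[-> ->]].
  - split; [auto|lia].
  - exfalso. rewrite J4 in K3 by lia. apply K4.
    erewrite square_eq in K3; [|apply (trap_stop1 _ _ T)|lia..]. injection K3 as <-. reflexivity.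
Qed.

Lemma hunted_sprung c bd k : Trap c bd -> hunted c bd k -> sprung c bd (cboard k).
Proof.
  intros T (k1 & ((D & J1 & J2 & J3 & J4) & _) & (D' & K1 & K2 & K3 & K4) & _).
  split; [auto|split; [|split]].
  - eapply square_eq; [exact K1|lia..].
  - intros x y Hin Hne.
    destruct (pair_dec x y (vcol c + 2) (vstart c - 1)) as [[-> ->]|N1]; [exact K2|].
    destruct (pair_dec x y (vcol c + 2 + -1) (vstart c - 1 + 0)) as [[-> ->]|N2]; [exact K3|].
    rewrite K4 by lia.
    destruct (pair_dec x y (vcol c + 2) (vstart c + 1)) as [[-> ->]|N3]; [exact J2|].
    eapply square_eq; [exact J3|unfold in_trap in Hin; lia..].
  - unfold in_trap. intros x y Hn. rewrite K4 by lia. apply J4; lia.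
Qed.

Lemma hunted_stuck c bd k : Trap c bd -> hunted c bd k -> ~ jump_avail k.
Proof.
  intros T H [k' S]. pose proof (hunted_sprung _ _ _ T H) as (D & R & _ & E).
  destruct H as (_ & _ & _ & Ex & Ey).
  destruct (jstep_inv k k' (vcol c) (vstart c - 1)) as (pc & du & dv & J & _); auto.
  destruct J as (K1 & K2 & (e & K3 & K4) & K5).
  assert (pc = RP) as -> by congruence. unfold dir in K2; cbn in K2, K4.
  rewrite E in K3 by (unfold in_trap; lia). apply K4.
  destruct K2 as [[-> ->]|[-> ->]].
  - erewrite square_eq in K3; [|apply (trap_stop2 _ _ T)|lia..]. injection K3 as <-. reflexivity.
  - erewrite square_eq in K3; [|apply (trap_stop3 _ _ T)|lia..]. injection K3 as <-. reflexivity.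
Qed.

Lemma trap_can c bd : Trap c bd -> can_jump bd (vcol c + 2) (vstart c + 1) 0 (-1) RP.
Proof.
  intros T. split; [apply (trap_hunter _ _ T)|]. split; [unfold dir; cbn; lia|]. split.
  - exists BP. split; [|easy]. eapply square_eq; [apply (trap_pawn _ _ T)|lia..].
  - eapply square_eq; [apply (trap_open _ _ T)|lia..].
Qed.

Lemma trap_step c bd x y k pc : Trap c bd -> bd x y = Some pc -> pcolor pc = Red ->
  jstep (mkConf bd x y) k -> hunting c bd k.
Proof.
  intros T E R S. destruct (dark_uv _ _ _ _ (trap_dark _ _ T) E) as (u & v & -> & ->).
  destruct (jstep_inv (mkConf bd (u - v) (u + v)) k u v) as (pc' & du & dv & J & H & Ex & Ey); auto.
  { apply (trap_dark _ _ T). }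
  cbn [cboard] in *.
  assert (pc' = pc) as -> by (destruct J as (J & _); unfold square in J; congruence).
  destruct (trap_only _ _ T _ _ _ _ _ R J) as (-> & -> & -> & -> & ->).
  split; [auto|lia].
Qed.

(** After one capture the pawn must go on, and after two it is stuck, so a finite jump has exactly
    two captures and an infinite one is impossible. *)
Lemma trap_reply c bd b' : Trap c bd ->
  finite_jump Red bd b' \/ infinite_jump Red bd b' -> sprung c bd b'.
Proof.
  intros T [(x & y & pc & k & E & R & S & N & Eb)|(x & y & pc & f & E & R & E0 & S & _)].
  - apply clos_trans_t1n_iff in S.
    assert (H : hunted c bd k).
    { destruct S as [k S|k1 k S Q].
      - pose proof (trap_step _ _ _ _ _ _ T E R S) as H. exfalso. apply N.
        pose proof (hunting_can _ _ _ T H) as C. destruct H as ((D & _) & Ex & Ey).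
        destruct (jstep_intro k _ _ _ _ _ D Ex Ey C) as (k' & S' & _). exists k'; auto.
      - pose proof (trap_step _ _ _ _ _ _ T E R S) as H.
        destruct Q as [k S'|k2 k S' Q]; [eapply hunting_step; eauto|].
        exfalso. pose proof (hunting_step _ _ _ _ T H S') as H'.
        apply (hunted_stuck _ _ _ T H'). destruct Q; eexists; eauto. }
    destruct (hunted_sprung _ _ _ T H) as (D & A & B & C).
    assert (Q : forall u v, square b' u v = square (cboard k) u v) by (intros; apply Eb).
    split; [eapply dark_ext; eauto|]. split; [rewrite Q; auto|].
    split; intros; rewrite Q; auto.
  - exfalso. pose proof (S O) as S0. rewrite E0 in S0.
    pose proof (trap_step _ _ _ _ _ _ T E R S0) as H.
    pose proof (hunting_step _ _ _ _ T H (S 1%nat)) as H'.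
    apply (hunted_stuck _ _ _ T H'). eexists. apply S.
Qed.

Lemma trap_reply_exists c bd : Trap c bd -> exists b', finite_jump Red bd b'.
Proof.
  intros T. set (x := vcol c + 2) in *. set (y := vstart c + 1) in *.
  destruct (jstep_intro (mkConf bd (x - y) (x + y)) x y 0 (-1) RP) as (k & S & _); auto.
  { apply (trap_dark _ _ T). } { apply trap_can, T. }
  pose proof (trap_step c bd (x - y) (x + y) k RP T (trap_hunter _ _ T) eq_refl S) as H.
  pose proof (hunting_can _ _ _ T H) as C. pose proof H as ((D & _) & Ex & Ey).
  destruct (jstep_intro k _ _ _ _ _ D Ex Ey C) as (k' & S' & _).
  exists (cboard k'), (x - y), (x + y), RP, k'.
  split; [apply (trap_hunter _ _ T)|]. split; [auto|]. split.
  - eapply t_trans; apply t_step; eauto.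
  - split; [|intros ? ?; reflexivity].
    eapply hunted_stuck; eauto. eapply hunting_step; eauto.
Qed.

(** * From the end of a walk to the trap, and on to the next king *)

Lemma landing_touches c q x y : far c -> x = vcol c /\ y = vstart c - 1 -> touches q x y -> q = c.
Proof. intros F [-> ->] T. destruct c as [c|c|]; try easy. near (xO c) T; auto; finish. Qed.

Lemma child_not_prefix m n q : chain m n -> (q = m \/ prefix q m) -> q <> xO n.
Proof.
  intros C H ->. pose proof (prefix_le _ _ (chain_prefix _ _ C)).
  destruct H as [H|H]; [|apply prefix_le in H; destruct H as [H|H]]; lia.
Qed.

(** The second alternative is the square where the red pawn lands, which [guard] does not
    contain. *)
Lemma gadget_fresh m n x y : chain m n ->
  guard (xO n) x y \/ x = vcol (xO n) /\ y = vstart (xO n) - 1 -> ~ spoiled m x y.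
Proof.
  intros C G H.
  assert (T : exists q, (q = m \/ prefix q m) /\ touches q x y).
  { destruct H as [H|(q & Q & _ & H)]; [exists m|exists q]; auto. split; auto. right; auto. }
  destruct T as (q & Q & T). apply (child_not_prefix m n q C Q).
  destruct G as [G|G]; [exact (guard_touches (xO n) q x y Logic.I G T)|].
  exact (landing_touches (xO n) q x y Logic.I G T).
Qed.

Lemma walked_trap lab m bd n l k b' : ready lab m bd -> walk m n AtEnd l -> walking m bd n AtEnd l k ->
  board_eq b' (cboard k) -> Trap (xO n) b'.
Proof.
  intros I T OK Eb. pose proof (ready_far _ _ _ I) as F.
  destruct (walk_valid _ _ _ _ F T) as [C V]. unfold valid in V.
  assert (Ea : vcol (xO n) = hend n - 3) by (coords; lia).
  assert (Ey : vstart (xO n) = hrow n + 3) by apply vstartO.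
  assert (Q : forall u v, square b' u v = square (cboard k) u v) by (intros; apply Eb).
  (* Squares to the left of the king at [AtEnd] or above it have not been reached by the walk. *)
  assert (Fresh : forall x y, x < hend n - 2 \/ hrow n + 2 < y ->
     guard (xO n) x y \/ x = vcol (xO n) /\ y = vstart (xO n) - 1 -> square b' x y = board0 lab x y).
  { intros x y Hxy G. pose proof (gadget_fresh m n x y C G) as NC.
    rewrite Q, (ok_same _ _ _ _ _ _ OK).
    - apply (ready_agree _ _ _ I), NC.
    - cbn [place_x place_y]. lia.
    - intros J. destruct (walk_captured _ _ _ _ _ _ F T J) as (J1 & J2 & _).
      cbn [place_x place_y] in *. lia.
    - intros K. apply kingsq_touches in K. apply (child_not_prefix m n m C); [auto|].
      destruct G as [G|G]; [exact (guard_touches (xO n) m x y Logic.I G K)|].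
      exact (landing_touches (xO n) m x y Logic.I G K). }
  assert (Clear : forall x y, clear_area x y -> square b' x y = Some RP).
  { intros x y Cl. rewrite Q. eapply clear_occupied; eauto.
    intros [-> ->]. destruct Cl as [_ Cl]. apply (Cl (xO n)). right. split; [easy|].
    cbn [place_x place_y]. lia. }
  assert (Full : forall x y, x < hend n - 2 \/ hrow n + 2 < y -> guard (xO n) x y -> square b' x y <> None).
  { intros x y H G. rewrite Fresh by auto. apply board0_occupied. exact (guard_not_empty (xO n) _ _ Logic.I G). }
  assert (King : square b' (vcol (xO n) + 1) (vstart (xO n) - 1) = Some BK).
  { rewrite Q. eapply square_eq; [apply (ok_king _ _ _ _ _ _ OK)|cbn [place_x place_y]; lia..]. }
  assert (Open : square b' (vcol (xO n) + 2) (vstart (xO n) - 1) = None).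
  { rewrite Q. apply (ok_captured _ _ _ _ _ _ OK); [cbn [place_x place_y]; lia|]. left.
    rewrite Ea, Ey. replace (hend n - 3 + 2) with (hend n - 1) by lia.
    replace (hrow n + 3 - 1) with (hrow n + 2) by lia. exact V. }
  constructor; auto.
  - eapply dark_ext; [exact Eb|apply (ok_dark _ _ _ _ _ _ OK)].
  - assert (G : guard (xO n) (vcol (xO n) + 2) (vstart (xO n) + 1)) by (unfold guard; lia).
    rewrite Fresh; [|lia|auto]. apply board0_RP.
    + exact (guard_not_empty (xO n) _ _ Logic.I G).
    + intros p K. pose proof (guard_touches (xO n) p _ _ Logic.I G (kingsq_touches _ _ _ K)). subst p.
      destruct K; lia.
    + intros p K. pose proof (guard_touches (xO n) p _ _ Logic.I G (pawnsq_touches _ _ _ K)). subst p.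
      destruct K; lia.
  - rewrite Fresh; [|lia|left; unfold guard; lia].
    apply (board0_BP lab (xO n)). unfold pawnsq. easy.
  - rewrite Fresh by (auto; lia). apply board0_empty. right. exists (xO n). right. split; [easy|]. lia.
  - intros x y du dv pc R (J1 & J2 & (e & J3 & J4) & J5).
    assert (pc = RP) as ->.
    { rewrite Q in J1.
      destruct (excluded_middle_informative (x = place_x n AtEnd /\ y = place_y n AtEnd)) as [[-> ->]|N1].
      { rewrite (ok_king _ _ _ _ _ _ OK) in J1. injection J1 as <-. easy. }
      destruct (excluded_middle_informative (In (x, y) l \/ kingsq m x y)) as [N2|N2].
      { rewrite (ok_captured _ _ _ _ _ _ OK) in J1 by auto. easy. }
      rewrite (ok_same _ _ _ _ _ _ OK) in J1 by auto. apply (ready_red _ _ _ I _ _ _ J1 R). }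
    unfold dir in J2; cbn in J2, J4.
    assert (Be : pcolor e = Black) by (destruct (pcolor e); easy).
    (* Red cannot take the arriving king at once: from the right, the attacker would stand on the
       square just emptied; from above, its landing square is occupied. *)
    destruct (excluded_middle_informative (x + du = place_x n AtEnd /\ y + dv = place_y n AtEnd)) as [[N1 N1']|N1].
    { exfalso. cbn [place_x place_y] in *. destruct J2 as [[-> ->]|[-> ->]].
      - rewrite (square_eq _ _ _ x y _ Open) in J1 by lia. discriminate.
      - rewrite Clear in J5; [discriminate|]. apply (clear_gadget (xO n)); [easy|lia]. }
    rewrite Q in J3.
    destruct (excluded_middle_informative (In (x + du, y + dv) l \/ kingsq m (x + du) (y + dv))) as [N2|N2].
    { rewrite (ok_captured _ _ _ _ _ _ OK) in J3 by auto. easy. }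
    rewrite (ok_same _ _ _ _ _ _ OK) in J3 by auto.
    destruct (ready_black _ _ _ I _ _ _ J3 Be) as [[K _]|(p & Fp & A & K)]; [tauto|].
    (* In the new gadget only the pawn, attacked from above, has an empty square behind it; the
       pieces of all other gadgets are still. *)
    destruct (Pos.eq_dec p (xO n)) as [->|Np].
    + destruct K as [(_ & K1 & K2)|(_ & K1 & K2)]; destruct J2 as [[-> ->]|[-> ->]].
      * exfalso. refine (Full _ _ _ _ J5); [lia|unfold guard; lia].
      * exfalso. rewrite Clear in J5; [discriminate|]. apply (clear_gadget (xO n)); [easy|lia].
      * exfalso. refine (Full _ _ _ _ J5); [lia|unfold guard; lia].
      * repeat split; lia.
    + exfalso.
      assert (St : still b' (x + du) (y + dv) e).
      { apply (still_intro lab b' p _ _ _ (fun x y => spoiled m x y \/ walked m x y \/ gadget (xO n) x y)); auto.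
        - intros s t N. rewrite Q, (ok_same _ _ _ _ _ _ OK).
          + apply (ready_agree _ _ _ I). tauto.
          + intros [-> ->]. apply N. right; right. split; [easy|]. cbn [place_x place_y]. lia.
          + intros J. apply N. destruct (walk_captured _ _ _ _ _ _ F T J) as (_ & _ & [(q & Cq & _ & B)|[_ B]]); auto.
            right; left; right. eauto.
          + intros J. apply N. right; left; left. exact J.
        - intros s t G [H|[H|H]].
          + exact (guard_off m p s t Fp A G H).
          + apply walked_touches in H as (q & Cq & H). apply A.
            rewrite (guard_touches p q s t Fp G H) in Cq.
            rewrite <- (chain_far m p Cq Fp). constructor.
          + apply Np. symmetry. apply (guard_touches p (xO n) s t Fp G). right; auto.
        - rewrite Q, (ok_same _ _ _ _ _ _ OK) by auto. exact J3. }
      destruct (still_safe _ _ _ _ St) as [S1 S2]. destruct J2 as [[-> ->]|[-> ->]].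
      * apply S1. eapply square_eq; [exact J5|lia..].
      * apply S2. eapply square_eq; [exact J5|lia..].
  - apply Clear, (clear_gadget (xO n)); [easy|lia].
  - apply Clear, (clear_gadget (xO n)); [easy|lia].
  - apply Clear, (clear_gadget (xO n)); [easy|lia].
Qed.

(** All changes of the round lie on tracks of proper prefixes of [xO n] or in its gadget, which
    [spoiled (xO n)] allows. *)
Lemma sprung_ready lab m bd n l k b1 b2 : ready lab m bd -> walk m n AtEnd l -> walking m bd n AtEnd l k ->
  board_eq b1 (cboard k) -> sprung (xO n) b1 b2 -> ready lab (xO n) b2.
Proof.
  intros I T OK Eb (D & R & Em & Same). pose proof (ready_far _ _ _ I) as F.
  destruct (walk_range _ _ _ _ F T) as [C _].
  assert (Ea : vcol (xO n) = hend n - 3) by (coords; lia).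
  assert (Ey : vstart (xO n) = hrow n + 3) by apply vstartO.
  assert (Q : forall u v, square b1 u v = square (cboard k) u v) by (intros; apply Eb).
  assert (Trap_ent : forall x y, in_trap (xO n) x y -> gadget (xO n) x y).
  { unfold in_trap. intros x y H. split; [easy|]. lia. }
  assert (Hl : forall x y, In (x, y) l -> spoiled (xO n) x y).
  { intros x y J. destruct (walk_captured _ _ _ _ _ _ F T J) as (_ & _ & [(q & Cm & Cq & B)|[_ B]]);
      [|left; exact B].
    right. exists q. split; [constructor; apply chain_prefix, Cq|].
    split; [|left; exact B]. intros ->. pose proof (prefix_le _ _ (chain_prefix _ _ Cq)). lia. }
  assert (Hm : forall x y, spoiled m x y -> spoiled (xO n) x y).
  { intros x y [E|(q & A & N & E)]; right; [exists m|exists q].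
    - split; [constructor; apply chain_prefix, C|]. split; [apply (child_not_prefix m n); auto|right; exact E].
    - split; [constructor|].
      + pose proof (chain_prefix _ _ C) as A'. clear - A A'.
        induction A' as [|r _ IH|r _ IH]; auto using prefix.
      + split; [apply (child_not_prefix m n); auto|exact E]. }
  assert (Hk : forall x y, kingsq m x y -> spoiled (xO n) x y).
  { intros x y K. right. exists m. split; [constructor; apply chain_prefix, C|].
    split; [apply (child_not_prefix m n); auto|]. apply kingsq_touches, K. }
  assert (Fresh : forall x y, guard (xO n) x y -> square bd x y = board0 lab x y).
  { intros x y G. apply (ready_agree _ _ _ I). apply (gadget_fresh m n); auto. }
  assert (Gk : guard (xO n) (vcol (xO n) + 4) (vstart (xO n))) by (unfold guard; lia).
  assert (Same' : forall x y, ~ in_trap (xO n) x y -> ~ In (x, y) l -> ~ kingsq m x y ->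
    square b2 x y = square bd x y).
  { intros x y N1 N2 N3. rewrite Same, Q by auto. apply (ok_same _ _ _ _ _ _ OK); auto.
    intros [-> ->]. apply N1. unfold in_trap. cbn [place_x place_y]. lia. }
  assert (Back : forall x y pc, square b2 x y = Some pc ->
    (x = vcol (xO n) /\ y = vstart (xO n) - 1 /\ pc = RP) \/
    ~ in_trap (xO n) x y /\ ~ In (x, y) l /\ ~ kingsq m x y /\ square bd x y = Some pc).
  { intros x y pc E.
    destruct (pair_dec x y (vcol (xO n)) (vstart (xO n) - 1)) as [[-> ->]|N0].
    { left. repeat split. congruence. }
    destruct (excluded_middle_informative (in_trap (xO n) x y)) as [N1|N1].
    { rewrite Em in E by auto. discriminate. }
    destruct (excluded_middle_informative (In (x, y) l \/ kingsq m x y)) as [N2|N2].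
    { rewrite Same, Q in E by auto. rewrite (ok_captured _ _ _ _ _ _ OK) in E; auto; [discriminate|].
      intros [-> ->]. apply N1. unfold in_trap. cbn [place_x place_y]. lia. }
    right. repeat split; auto. rewrite <- Same'; auto. }
  constructor; auto.
  - easy.
  - intros x y N. rewrite Same'.
    + apply (ready_agree _ _ _ I). auto.
    + intros H. apply N. left. auto.
    + auto.
    + auto.
  - intros x y pc E B.
    destruct (Back _ _ _ E) as [(_ & _ & ->)|(N1 & N2 & N3 & E')]; [easy|].
    destruct (ready_black _ _ _ I _ _ _ E' B) as [[K _]|(p & Fp & A & K)]; [tauto|].
    destruct (Pos.eq_dec p (xO n)) as [->|Np].
    + left. destruct K as [K|(_ & -> & ->)].
      * split; auto. pose proof (kingsq_guard _ _ _ K) as G. rewrite Fresh in E' by auto.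
        destruct (board0_black _ _ _ _ E' B) as [(p & Kp & L & ->)|(p & Kp & _)].
        -- rewrite (guard_touches (xO n) p x y Logic.I G (kingsq_touches _ _ _ Kp)) in L. auto.
        -- pose proof (guard_touches (xO n) p x y Logic.I G (pawnsq_touches _ _ _ Kp)). subst p.
           unfold kingsq, pawnsq in *. lia.
      * exfalso. apply N1. unfold in_trap. lia.
    + right. exists p. split; auto. split; auto. intros A'. apply A.
      inversion A'; subst; [easy|]. eapply prefix_chain_far; eauto.
  - intros x y pc E B.
    destruct (Back _ _ _ E) as [(_ & _ & ->)|(N1 & N2 & N3 & E')]; [easy|].
    eapply (ready_red _ _ _ I); eauto.
  - apply Em; [unfold in_trap|]; lia.
  - intros L. rewrite Same'.
    + rewrite Fresh by auto. apply (board0_BK lab (xO n)); auto. easy.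
    + unfold in_trap. lia.
    + intros J. destruct (walk_captured _ _ _ _ _ _ F T J) as (_ & H & _). cbn [place_x place_y] in H. lia.
    + intros K. apply kingsq_touches in K.
      apply (child_not_prefix m n m C); auto. exact (guard_touches (xO n) m _ _ Logic.I Gk K).
Qed.

(** * Values *)

(* [board0] as it is when the pawn that blocks the king of [m] has just been captured. *)
Definition opening (lab : positive -> Prop) (m : positive) : board := fun x y =>
  if Z.even (x + y) then
    let u := (x + y) / 2 in let v := (y - x) / 2 in
    if excluded_middle_informative (pawnsq m u v) then None else board0 lab u v
  else None.

Lemma square_opening lab m u v : square (opening lab m) u v =
  if excluded_middle_informative (pawnsq m u v) then None else board0 lab u v.
Proof.
  unfold square, opening.
  replace (u - v + (u + v)) with (2 * u) by lia. replace (u + v - (u - v)) with (2 * v) by lia.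
  rewrite Z.even_mul. cbn [Z.even orb]. cbv zeta.
  replace (2 * u / 2) with u by lia. replace (2 * v / 2) with v by lia. reflexivity.
Qed.

(** Since [n] lies on the chain of the root, [xO n] is its own only far prefix, and no other gadget
    counts as used. *)
Lemma opening_ready lab n : chain xH n -> ready lab (xO n) (opening lab (xO n)).
Proof.
  intros C. set (m := xO n).
  assert (A : forall p, far p -> p <> m -> ~ prefix p m).
  { intros p F N A. inversion A; subst; [easy|].
    assert (H' : prefix p 1%positive) by (eapply prefix_chain_far; eauto). inversion H'; subst. easy. }
  constructor; try easy.
  - intros x y E. unfold opening. rewrite E. reflexivity.
  - intros x y N. rewrite square_opening. destruct excluded_middle_informative as [K|_]; auto.
    destruct N. left. destruct K as (_ & -> & ->). split; [easy|lia].
  - intros x y pc. rewrite square_opening. destruct excluded_middle_informative as [K|N]; [easy|].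
    intros E B. destruct (board0_black _ _ _ _ E B) as [(p & K & L & ->)|(p & K & ->)].
    + destruct (Pos.eq_dec p m) as [->|Np]; [auto|].
      right. exists p. split; [apply K|]. split; [apply A; [apply K|auto]|auto].
    + destruct (Pos.eq_dec p m) as [->|Np]; [easy|].
      right. exists p. split; [apply K|]. split; [apply A; [apply K|auto]|auto].
  - intros x y pc. rewrite square_opening. destruct excluded_middle_informative as [K|N]; [easy|].
    apply board0_red.
  - rewrite square_opening. destruct excluded_middle_informative as [K|N]; auto. now elim N.
  - intros L. rewrite square_opening. destruct excluded_middle_informative as [K|N].
    + destruct K. lia.
    + apply (board0_BK lab m); easy.
Qed.

(** * Ordinals, their enumerated members and the labels of nodes *)

Definition zero : Ord := OSup Empty_set (fun e => match e with end).

Lemma ole_refl a : ole a a.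
Proof. induction a as [Ix f IH]. intros i. exists i. apply IH. Qed.

Lemma ole_trans a b c : ole a b -> ole b c -> ole a c.
Proof.
  revert b c. induction a as [Ix f IH]. intros [J g] [K h] H1 H2 i.
  destruct (H1 i) as [j Hj]. destruct (H2 j) as [k Hk]. exists k. eapply IH; eauto.
Qed.

Definition nonzero (a : Ord) : Prop := match a with OSup Ix _ => inhabited Ix end.

Lemma olt_zero a : nonzero a -> olt zero a.
Proof. destruct a as [Ix f]. intros [j]. exists j. destruct (f j); intros []. Qed.

(* Indices that list no member of [a] get the child [zero]; such extra leaves do not affect the
   value of a node with at least one child. *)
Definition lists_members (a : Ord) (e : nat -> Ord) : Prop :=
  match a with OSup Ix f =>
    (forall i, (exists j, e i = f j) \/ e i = zero) /\ (forall j, exists i, e i = f j)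
  end.

Definition children (a : Ord) : nat -> Ord :=
  epsilon (inhabits (fun _ => zero)) (lists_members a).

Lemma children_spec a : countable_ord a -> lists_members a (children a).
Proof.
  intros H. unfold children. apply epsilon_spec. destruct H as [Ix f [g inj] _].
  exists (fun i => match excluded_middle_informative (exists j, g j = i) with
    | left H => f (proj1_sig (constructive_indefinite_description _ H))
    | right _ => zero end).
  split.
  - intros i. destruct excluded_middle_informative; eauto.
  - intros j. exists (g j). destruct excluded_middle_informative as [H|[]]; [|eauto].
    destruct constructive_indefinite_description as [j' E]. cbn. f_equal. auto.
Qed.

(** The ordinal belongs to the node where the current walk began; the index tells which of its
    children the track of [p] leads to. *)
Fixpoint label (a : Ord) (p : positive) : Ord * nat :=
  match p with
  | xH => (a, O)
  | xI q => let (b, i) := label a q in (b, S i)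
  | xO q => let (b, i) := label a q in (children b i, O)
  end.

Lemma label_chain a m b n : label a m = (b, O) -> chain m n -> exists i, label a n = (b, i).
Proof.
  intros E. induction 1 as [|n C [i H]]; [eauto|]. exists (S i). cbn. rewrite H. reflexivity.
Qed.

Lemma chain_label a m b i : label a m = (b, O) -> exists n, chain m n /\ label a n = (b, i).
Proof.
  intros E. induction i as [|i (n & C & H)]; [eauto using chain|].
  exists (xI n). split; [auto using chain|]. cbn. rewrite H. reflexivity.
Qed.

Lemma label_O a n b i : label a n = (b, i) -> label a (xO n) = (children b i, O).
Proof. intros E. cbn. rewrite E. reflexivity. Qed.

Definition live (a : Ord) (p : positive) : Prop := nonzero (fst (label a p)).

Section Values.
Context (root : Ord).
Notation lab := (live root).

Lemma leaf_won m p : pturn p = Black -> ready lab m (pboard p) -> ~ lab m -> wonRed p.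
Proof.
  intros T I L. split; auto. apply stuck_black; [auto|apply (ready_dark _ _ _ I)|].
  intros x y pc E B. destruct (ready_black _ _ _ I _ _ _ E B) as [(_ & L' & _)|(q & F & A & K)]; [easy|].
  eapply ready_still; eauto.
Qed.

Lemma live_jump m bd : ready lab m bd -> lab m -> has_jump Black bd.
Proof.
  intros I L.
  pose proof (hop_can_jump _ _ _ _ _ _ _ _ _ _ _ I (walk_K m) (start_walking _ _ _ I L) (hop_K m)) as J.
  apply has_jump_intro in J; auto. apply (ready_dark _ _ _ I).
Qed.

Lemma live_move m p n : pturn p = Black -> ready lab m (pboard p) -> lab m -> chain m n ->
  exists l k, walk m n AtEnd l /\ walking m (pboard p) n AtEnd l k /\ move p (mkPos (cboard k) Red).
Proof.
  intros T I L C. destruct (finite_jump_intro _ _ _ _ I L C) as (l & k & Tk & OK & J).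
  exists l, k. split; auto. split; auto. split; [rewrite T; auto|].
  rewrite T. split; [auto|]. intros N. destruct N. eapply live_jump; eauto.
Qed.

Lemma reply m n l k bd q : ready lab m bd -> walk m n AtEnd l -> walking m bd n AtEnd l k ->
  board_eq (pboard q) (cboard k) -> pturn q = Red ->
  (exists q', move q q') /\
  forall q', move q q' -> pturn q' = Black /\ ready lab (xO n) (pboard q').
Proof.
  intros I Tk OK E T. pose proof (walked_trap _ _ _ _ _ _ _ I Tk OK E) as Tr.
  assert (HJ : has_jump Red (pboard q)).
  { eapply (has_jump_intro _ _ _ _ _ RP); [apply (trap_dark _ _ Tr)|apply (trap_can _ _ Tr)]. }
  split.
  - destruct (trap_reply_exists _ _ Tr) as [b' J]. exists (mkPos b' Black).
    split; [rewrite T; auto|]. rewrite T. split; [auto|]. easy.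
  - intros q' (T' & M & _). rewrite T in *. split; [auto|].
    eapply sprung_ready; eauto. apply trap_reply; auto.
Qed.

Lemma value_le a : countable_ord a -> forall m p, pturn p = Black -> ready lab m (pboard p) ->
  label root m = (a, O) -> LEval p a.
Proof.
  intros Ca. induction Ca as [Ix f Hg Hf IH]. intros m p T I E.
  set (a := OSup Ix f) in *.
  assert (Ca : countable_ord a) by (constructor; auto).
  assert (L : lab m <-> inhabited Ix) by (unfold live; rewrite E; reflexivity).
  destruct (excluded_middle_informative (inhabited Ix)) as [Hi|Hi].
  2: { apply LE_won. eapply leaf_won; eauto. tauto. }
  apply L in Hi. apply LE_black; auto.
  - intros [_ W]. apply W.
    destruct (live_move m p m T I Hi (chain_refl m)) as (l & k & _ & _ & M). eauto.
  - intros q (Tq & M & _). rewrite T in *. cbn [opp] in Tq.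
    destruct (M (live_jump _ _ I Hi)) as [J|J].
    + destruct (finite_jump_inv _ _ _ _ I J) as (_ & n & l & k & Tk & OK & Eq).
      destruct (reply m n l k _ q I Tk OK Eq Tq) as [[q' Mq] R].
      destruct (R q' Mq) as [T' I'].
      destruct (walk_range _ _ _ _ (ready_far _ _ _ I) Tk) as [C _].
      destruct (label_chain _ _ _ _ E C) as [i Ei].
      pose proof (label_O _ _ _ _ Ei) as Ec.
      destruct (proj1 (children_spec a Ca) i) as [[j Ej]|Ez].
      * apply LE_red with q' (f j); auto.
        -- eapply IH; eauto. rewrite Ec, Ej. reflexivity.
        -- exists j. apply ole_refl.
      * apply LE_red with q' zero; auto.
        -- apply LE_won. eapply leaf_won; eauto. unfold live. rewrite Ec, Ez. intros [[]].
        -- apply olt_zero. apply L, Hi.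
    + destruct (endless_reply _ _ _ _ I J) as (q' & Mq & W).
      apply LE_red with q' zero; auto.
      * destruct q as [bq cq]. cbn in Tq. subst cq. exact Mq.
      * apply LE_won, W.
      * apply olt_zero. apply L, Hi.
Qed.

(** For each member, Black can walk to the sibling whose index lists it, and every reply of Red then
    leads to that child. *)
Lemma value_ge a : countable_ord a -> forall m p b, pturn p = Black -> ready lab m (pboard p) ->
  label root m = (a, O) -> LEval p b -> ole a b.
Proof.
  intros Ca. induction Ca as [Ix f Hg Hf IH]. intros m p b T I E V j.
  set (a := OSup Ix f) in *.
  assert (Ca : countable_ord a) by (constructor; auto).
  assert (L : lab m) by (unfold live; rewrite E; exact (inhabits j)).
  destruct (proj2 (children_spec a Ca) j) as [i Ei].
  destruct (chain_label root m a i E) as (n & C & En).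
  pose proof (label_O _ _ _ _ En) as Ec. rewrite Ei in Ec.
  destruct (live_move m p n T I L C) as (l & k & Tk & OK & M).
  inversion V as [p' a' [_ W]|p' q a' b' T'|p' a' T' _ H]; subst.
  - destruct W. eauto.
  - congruence.
  - specialize (H _ M). inversion H as [p' a' [W _]|p' q a' b' _ Mq Vq O|p' a' W]; subst; try easy.
    destruct (reply m n l k _ (mkPos (cboard k) Red) I Tk OK) as [_ R]; auto.
    { intros u w. reflexivity. }
    destruct (R q Mq) as [Tq Iq].
    pose proof (IH j (xO n) q b' Tq Iq Ec Vq) as Hle.
    destruct b as [J g]. destruct O as [j' Hj']. exists j'. eapply ole_trans; eauto.
Qed.
End Values.

Theorem theorem1 :
  forall alpha : Ord, countable_ord alpha ->
    exists p : position, wf_position p /\ has_value p alpha.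
Proof.
  intros alpha Ca.
  (* Only child nodes have a waiting king, so [alpha] becomes the sole member of an auxiliary root,
     and play starts at a child labelled [alpha], at whatever index [children] lists it. *)
  set (root := OSup unit (fun _ => alpha)).
  assert (Cr : countable_ord root).
  { constructor; auto. exists (fun _ => O). intros [] []. reflexivity. }
  destruct (proj2 (children_spec root Cr) tt) as [i Ei].
  destruct (chain_label root xH root i eq_refl) as (n & C & En).
  pose proof (label_O _ _ _ _ En) as E. rewrite Ei in E.
  pose proof (opening_ready (live root) n C) as I.
  exists (mkPos (opening (live root) (xO n)) Black). split.
  - apply (ready_dark _ _ _ I).
  - split.
    + apply (value_le root alpha Ca (xO n)); auto.
    + intros b V. apply (value_ge root alpha Ca (xO n)) in V; auto.
Qed.
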